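(* Let $\nu\in\mathscr{W}(M,K)$ and assume $0\in\Omega(\mu)$. Then $\nu$ is stable. In particular it is polystable, so there is $g\in G$ such that $\mathfrak{F}(g_*\nu)=0$.
   Context: Setting. $(M,J,\omega)$ is a compact Kähler manifold with Riemannian metric $g_M$, $\omega(X,Y)=g_M(JX,Y)$. $K$ is a compact connected Lie group with Lie algebra $\mathfrak{k}$ acting on $M$ almost effectively (i.e. $v_M=0$ implies $v=0$ for $v\in\mathfrak{k}$, $v_M$ the fundamental vector field) and by holomorphic isometries. The action is Hamiltonian with momentum mapping $\mu:M\to\mathfrak{k}^*$: $\mu$ is $K$-equivariant and $d\mu^v=i_{v_M}\omega$, where $\mu^v=\langle\mu,v\rangle$. The action extends to a holomorphic action of $G=K^{\mathbb C}$ with $(iv)_M=Jv_M=\operatorname{grad}\mu^v$ for $v \in \mathfrak{k}$. For every $x\in M$ and $v\in\mathfrak{k}$ the limit $\lim_{t\to+\infty}\exp(itv)\cdot x$ exists. $S(\mathfrak{k})$ is the unit sphere for a fixed $\operatorname{Ad}$-invariant scalar product on $\mathfrak{k}$. $\Omega(\mu)$ is the interior in $\mathfrak{k}^*$ of the convex hull of $\mu(M)$. $\mathscr{W}(M,K)=\mathscr{W}(M,K,\omega,\mu)$ is the set of Borel probability measures $\nu$ on $M$ such that for every $v\in S(\mathfrak{k})$ one has $\nu(W^u_r)=1$, where $c_r=\max_M\mu^v$ is the largest critical value of $\mu^v$ and $W^u_r=\{x\in M:\lim_{t\to+\infty}\exp(itv)\cdot x\in(\mu^v)^{-1}(c_r)\}$.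 $G$ acts on the set $\mathscr{P}(M)$ of Borel probability measures by push-forward, $g\cdot\nu=g_*\nu$; $G_\nu$ is the stabilizer of $\nu$ and $\mathfrak{g}_\nu$ its Lie algebra. $\mathfrak{F}:\mathscr{P}(M)\to\mathfrak{k}^*$ is $\mathfrak{F}(\nu)=\int_M\mu(x)\,d\nu(x)$. $\nu$ is polystable if $G\cdot\nu\cap\mathfrak{F}^{-1}(0)\neq\emptyset$; $\nu$ is stable if it is polystable and $\mathfrak{g}_\nu$ is conjugate (under $\operatorname{Ad}(G)$) to a subalgebra of $\mathfrak{k}$. *)

(* Defs.v *)
From HB Require Import structures.
From mathcomp Require Import all_boot all_order all_algebra.
From mathcomp Require Import all_classical all_reals all_analysis.
Import Order.TTheory GRing.Theory Num.Theory.
Import numFieldNormedType.Exports.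

Set Implicit Arguments.
Unset Strict Implicit.
Unset Printing Implicit Defensive.

Local Open Scope classical_set_scope.
Local Open Scope ring_scope.

(* Manifolds are described by atlases, and tangent vectors, differentials and
   tensor fields by their components in the charts.  An atlas is plain data, and
   the axioms are gathered in predicates such as [manifold].  Values taken by a
   chart or a component outside the domain of its chart are never used. *)

#[short(type="topGroupType")]
HB.structure Definition TopGroup := {G of Group G & Topological G}.

Fixpoint Ck (R : realType) (V W : normedModType R) (k : nat) (U : set V)
    (f : V -> W) : Prop :=
  match k with
  | 0 => forall x, U x -> {for x, continuous f}
  | k'.+1 => (forall x, U x -> differentiable f x) /\
             (forall v, Ck k' U (fun x => 'D_v f x))
  end.

Definition smooth_on (R : realType) (V W : normedModType R) (U : set V)
  (f : V -> W) : Prop := forall k, Ck k U f.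

Record atlas (R : realType) (V : normedModType R) (M : topologicalType) :=
  Atlas {
    ix : Type;
    cdom : ix -> set M;
    chart : ix -> M -> V;
    cinv : ix -> V -> M }.

Arguments ix {R V M} a.
Arguments cdom {R V M} a i _.
Arguments chart {R V M} a i _.
Arguments cinv {R V M} a i _.

Definition triv_atlas (R : realType) (V : normedModType R) : atlas V V :=
  @Atlas R V V unit (fun _ => setT) (fun _ x => x) (fun _ x => x).

Definition prod_atlas (R : realType) (V W : normedModType R)
    (M N : topologicalType) (A : atlas V M) (B : atlas W N) :
    atlas (V * W)%type (M * N)%type :=
  @Atlas R (V * W)%type (M * N)%type (ix A * ix B)%type
    (fun i => cdom A i.1 `*` cdom B i.2)
    (fun i p => (chart A i.1 p.1, chart B i.2 p.2))
    (fun i y => (cinv A i.1 y.1, cinv B i.2 y.2)).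

Section Manifolds.
Context {R : realType} {V W : normedModType R} {M N : topologicalType}.
Variables (A : atlas V M) (B : atlas W N).

Definition loc (f : M -> N) (i : ix A) (j : ix B) : V -> W :=
  chart B j \o f \o cinv A i.

(* The differential of f at x, from the chart i at x to the chart j at f x. *)
Definition dmap (f : M -> N) (i : ix A) (j : ix B) (x : M) (u : V) : W :=
  'D_u (loc f i j) (chart A i x).

Definition smooth_map (f : M -> N) : Prop :=
  continuous f /\
  forall i j, smooth_on (chart A i @` (cdom A i `&` f @^-1` cdom B j))
                        (loc f i j).

End Manifolds.

Definition diffeomorphism (R : realType) (V W : normedModType R)
    (M N : topologicalType) (A : atlas V M) (B : atlas W N) (f : M -> N) :=
  smooth_map A B f /\
  exists f' : N -> M, [/\ cancel f f', cancel f' f & smooth_map B A f'].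

Record manifold (R : realType) (V : normedModType R) (M : topologicalType)
    (A : atlas V M) : Prop := Manifold {
  manifold_hausdorff : hausdorff_space M;
  manifold_second_countable : @second_countable M;
  manifold_cover : forall x, exists i, cdom A i x;
  manifold_open_cdom : forall i, open (cdom A i);
  manifold_open_image : forall i, open (chart A i @` cdom A i);
  manifold_chartK : forall i x, cdom A i x -> cinv A i (chart A i x) = x;
  manifold_chart_cont :
    forall i x, cdom A i x -> {for x, continuous (chart A i)};
  manifold_cinv_cont :
    forall i x, cdom A i x -> {for chart A i x, continuous (cinv A i)};
  manifold_transition : smooth_map A A idfun }.

(* C^n as R^n x R^n, where (x, y) stands for x + iy. *)
Definition Cn (R : realType) (n : nat) : normedModType R :=
  ('rV[R]_n * 'rV[R]_n)%type.

Definition J0 (R : realType) (n : nat) (z : Cn R n) : Cn R n := (- z.2, z.1).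

Definition Jprod (V W : Type) (J : V -> V) (J' : W -> W) (z : V * W) : V * W :=
  (J z.1, J' z.2).

Definition holomorphic (R : realType) (V W : normedModType R)
    (M N : topologicalType) (J : V -> V) (J' : W -> W)
    (A : atlas V M) (B : atlas W N) (f : M -> N) : Prop :=
  smooth_map A B f /\
  forall i j x, cdom A i x -> cdom B j (f x) ->
    forall u, dmap f i j x (J u) = J' (dmap f i j x u).

Definition complex_manifold (R : realType) (n : nat) (M : topologicalType)
    (A : atlas (Cn R n) M) : Prop :=
  manifold A /\ holomorphic (@J0 R n) (@J0 R n) A A idfun.

Record scalar_product (R : realType) (V : lmodType R) (q : V -> V -> R) :
    Prop := ScalarProduct {
  sp_linear : forall a u v w, q (a *: u + v) w = a * q u w + q v w;
  sp_sym : forall u v, q u v = q v u;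
  sp_pos : forall u, u != 0 -> 0 < q u u }.

(* [g i x] is the metric at x read in the chart i. *)
Definition tensor2 (R : realType) (V : normedModType R) (M : topologicalType)
  (A : atlas V M) := ix A -> M -> V -> V -> R.

Record riemannian (R : realType) (V : normedModType R) (M : topologicalType)
    (A : atlas V M) (g : tensor2 A) : Prop := Riemannian {
  riemannian_sp : forall i x, cdom A i x -> scalar_product (g i x);
  riemannian_tensor : forall i j x, cdom A i x -> cdom A j x ->
    forall u v,
      g i x u v = g j x (dmap idfun i j x u) (dmap idfun i j x v);
  riemannian_smooth : forall i u v,
    smooth_on (chart A i @` cdom A i) (fun y => g i (cinv A i y) u v : R^o) }.

Definition isometry (R : realType) (V : normedModType R) (M : topologicalType)
    (A : atlas V M) (g : tensor2 A) (f : M -> M) : Prop :=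
  forall i j x, cdom A i x -> cdom A j (f x) ->
    forall u v,
      g j (f x) (dmap f i j x u) (dmap f i j x v) = g i x u v.

(* omega(X, Y) = g(JX, Y) *)
Definition kform (R : realType) (d : nat) (M : topologicalType)
  (A : atlas (Cn R d) M) (g : tensor2 A) : tensor2 A :=
  fun i x u v => g i x (J0 u) v.

(* [kaehler_closed] is d omega = 0, evaluated on coordinate (hence commuting)
   vector fields. *)
Record kaehler (R : realType) (d : nat) (M : topologicalType)
    (A : atlas (Cn R d) M) (g : tensor2 A) : Prop := Kaehler {
  kaehler_complex : complex_manifold A;
  kaehler_riemannian : riemannian g;
  kaehler_hermitian : forall i x, cdom A i x ->
    forall u v, g i x (J0 u) (J0 v) = g i x u v;
  kaehler_closed : forall i x, cdom A i x -> forall u v w,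
    let om a b : Cn R d -> R^o := fun y => kform g i (cinv A i y) a b in
    'D_u (om v w) (chart A i x) + 'D_v (om w u) (chart A i x)
      + 'D_w (om u v) (chart A i x) = 0 }.

(* The Lie algebra of a Lie group is its tangent space at 1, read in a fixed
   chart e around 1; as a vector space it is thus the model space V. *)
Section LieGroups.
Context {R : realType} {V : normedModType R} {G : topGroupType}.
Variables (A : atlas V G) (e : ix A).

Record lie_group : Prop := LieGroup {
  lie_manifold : manifold A;
  lie_chart1 : cdom A e 1%g;
  lie_mul :
    smooth_map (prod_atlas A A) A (fun p : G * G => (p.1 * p.2)%g);
  lie_inv : smooth_map A A (fun x : G => x^-1%g) }.

Definition velocity (c : R -> G) : V := 'D_1 (chart A e \o c : R^o -> V) 0.

Definition smooth_curve (c : R -> G) : Prop :=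
  smooth_map (triv_atlas (R^o : normedModType R)) A c.

(* These properties determine the exponential map of a Lie group. *)
Definition is_exp (ex : V -> G) : Prop :=
  forall v, [/\ smooth_curve (fun t => ex (t *: v)),
    forall s t : R, ex ((s + t) *: v) = (ex (s *: v) * ex (t *: v))%g
    & velocity (fun t => ex (t *: v)) = v].

Definition Ad (h : G) (v : V) : V :=
  dmap (fun x : G => (h * x * h^-1)%g) e e 1%g v.

(* [v, w] is the derivative at 1 of h |-> Ad h w in the direction v. *)
Definition bracket (v w : V) : V :=
  'D_v (fun y => Ad (cinv A e y) w) (chart A e 1%g).

Definition lie_subalgebra (h : set V) : Prop :=
  [/\ h 0, forall a u v, h u -> h v -> h (a *: u + v)
    & forall u v, h u -> h v -> h (bracket u v)].

(* The tangent space at 1 of a closed (hence embedded) subgroup H: the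
   velocities at 0 of the smooth curves contained in H. *)
Definition lie_algebra_of (H : set G) : set V :=
  [set xi | exists c : R -> G,
    [/\ smooth_curve c, c 0 = 1%g, forall t, H (c t) & velocity c = xi]].

Definition fundamental (W : normedModType R) (M : topologicalType)
    (B : atlas W M) (a : G -> M -> M) (v : V) (i : ix B) (x : M) : W :=
  dmap (fun h => a h x) e i 1%g v.

Definition smooth_action (W : normedModType R) (M : topologicalType)
    (B : atlas W M) (a : G -> M -> M) : Prop :=
  [/\ forall x, a 1%g x = x,
      forall h k x, a (h * k)%g x = a h (a k x)
    & smooth_map (prod_atlas A B) B (fun p : G * M => a p.1 p.2)].

Definition invariant_scalar_product (q : V -> V -> R) : Prop :=
  scalar_product q /\ forall h u v, q (Ad h u) (Ad h v) = q u v.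

End LieGroups.

Definition complex_lie_group (R : realType) (n : nat) (G : topGroupType)
    (A : atlas (Cn R n) G) (e : ix A) : Prop :=
  [/\ lie_group e, complex_manifold A,
      holomorphic (Jprod (@J0 R n) (@J0 R n)) (@J0 R n) (prod_atlas A A) A
        (fun p : G * G => (p.1 * p.2)%g)
    & holomorphic (@J0 R n) (@J0 R n) A A (fun x : G => x^-1%g)].

Section Complexification.
Context {R : realType} {n : nat} {K G : topGroupType}.
Variables (AK : atlas 'rV[R]_n K) (eK : ix AK).
Variables (AG : atlas (Cn R n) G) (eG : ix AG).
Variable (iota : K -> G).

Definition diota (v : 'rV[R]_n) : Cn R n := dmap iota eK eG 1%g v.

(* The element iv of the complexified Lie algebra, for v in Lie(K). *)
Definition imul (v : 'rV[R]_n) : Cn R n := J0 (diota v).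

(* G is the complexification of the compact group K: it is a complex Lie group
   whose Lie algebra is the direct sum of Lie(K) and i Lie(K), and it has the
   polar decomposition G = K exp(i Lie(K)). *)
Record complexification (ex : Cn R n -> G) : Prop := Complexification {
  cplx_lie : complex_lie_group eG;
  cplx_exp : is_exp eG ex;
  cplx_morph : forall h k, iota (h * k)%g = (iota h * iota k)%g;
  cplx_smooth : smooth_map AK AG iota;
  cplx_sum : forall xi : Cn R n,
    exists! p : 'rV[R]_n * 'rV[R]_n, xi = diota p.1 + imul p.2;
  cplx_polar : diffeomorphism
    (prod_atlas AK (triv_atlas ('rV[R]_n : normedModType R))) AG
    (fun p : K * 'rV[R]_n => (iota p.1 * ex (imul p.2))%g) }.

End Complexification.

(* Elements of the dual of Lie(K) = R^n are given by their coordinates in the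
   dual basis. *)
Definition pairing (R : realType) (n : nat) (f v : 'rV[R]_n) : R :=
  (f *m v^T) 0 0.

Section HamiltonianActions.
Context {R : realType} {n d : nat} {K G : topGroupType} {M : topologicalType}.
Variables (AM : atlas (Cn R d) M) (g : tensor2 AM).
Variables (AK : atlas 'rV[R]_n K) (eK : ix AK).
Variables (AG : atlas (Cn R n) G) (eG : ix AG) (iota : K -> G).
Variables (aK : K -> M -> M) (aG : G -> M -> M) (mu : M -> 'rV[R]_n).

Definition mu_comp (v : 'rV[R]_n) (x : M) : R^o := pairing (mu x) v.

(* d mu^v at x, applied to the vector u *)
Definition dmu_comp (v : 'rV[R]_n) (i : ix AM) (x : M) (u : Cn R d) : R^o :=
  @dmap _ _ _ _ _ AM (triv_atlas (R^o : normedModType R)) (mu_comp v) i tt x u.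

Record kaehler_action : Prop := KaehlerAction {
  ka_action : smooth_action AK AM aK;
  ka_holomorphic : forall k, holomorphic (@J0 R d) (@J0 R d) AM AM (aK k);
  ka_isometry : forall k, isometry g (aK k);
  ka_almost_effective : forall v,
    (forall i x, cdom AM i x -> fundamental eK aK v i x = 0) -> v = 0 }.

Record momentum_map : Prop := MomentumMap {
  mm_smooth : smooth_map AM (triv_atlas ('rV[R]_n : normedModType R)) mu;
  mm_equivariant : forall k x v,
    pairing (mu (aK k x)) v = pairing (mu x) (Ad eK (k^-1)%g v);
  mm_contraction : forall v i x, cdom AM i x -> forall u,
    dmu_comp v i x u = kform g i x (fundamental eK aK v i x) u }.

(* [hx_JvM] and [hx_grad] say that (iv)_M = J v_M = grad mu^v. *)
Record holomorphic_extension : Prop := HolomorphicExtension {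
  hx_action : smooth_action AG AM aG;
  hx_holomorphic :
    holomorphic (Jprod (@J0 R n) (@J0 R d)) (@J0 R d) (prod_atlas AG AM) AM
      (fun p : G * M => aG p.1 p.2);
  hx_extends : forall k x, aG (iota k) x = aK k x;
  hx_JvM : forall v i x, cdom AM i x ->
    fundamental eG aG (imul eK eG iota v) i x
      = J0 (fundamental eK aK v i x);
  hx_grad : forall v i x, cdom AM i x -> forall u,
    g i x (fundamental eG aG (imul eK eG iota v) i x) u = dmu_comp v i x u }.

End HamiltonianActions.

Definition convex_hull (R : realType) (V : lmodType R) (A : set V) : set V :=
  [set x | forall C : set V, convex_set C -> A `<=` C -> C x].

Definition Omega (R : realType) (n : nat) (M : Type) (mu : M -> 'rV[R]_n) :
  set 'rV[R]_n := interior (convex_hull (range mu)).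

Definition borel (M : ptopologicalType) := g_sigma_algebraType (@open M).

Section Measures.
Context {R : realType} {n : nat} {K G : topGroupType} {M : ptopologicalType}.
Variables (AK : atlas 'rV[R]_n K) (eK : ix AK).
Variables (AG : atlas (Cn R n) G) (eG : ix AG) (iota : K -> G).
Variables (ex : Cn R n -> G) (aG : G -> M -> M) (mu : M -> 'rV[R]_n).
Implicit Types nu : probability (borel M) R.

(* t |-> exp(itv) x *)
Definition iflow (v : 'rV[R]_n) (x : M) (t : R) : M :=
  aG (ex (t *: imul eK eG iota v)) x.

(* The set W^u_r attached to the maximum c_r of mu^v. *)
Definition max_unstable (v : 'rV[R]_n) : set M :=
  [set x | exists2 y : M, iflow v x t @[t --> +oo] --> y
           & mu_comp mu v y = sup (range (mu_comp mu v))].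

Definition measures_W (q : 'rV[R]_n -> 'rV[R]_n -> R) :
  set (probability (borel M) R) :=
  [set nu | forall v, q v v = 1 -> nu (max_unstable v) = 1%E].

(* The push-forward of nu by h, as a set function. *)
Definition push (h : G) nu : set (borel M) -> \bar R :=
  pushforward nu (aG h : borel M -> borel M).

Definition measure_orbit nu : set (probability (borel M) R) :=
  [set nu' | exists h, forall B : set (borel M),
    measurable B -> nu' B = push h nu B].

Definition measure_stabilizer nu : set G :=
  [set h | forall B : set (borel M), measurable B -> push h nu B = nu B].

(* The integral of mu, coordinate by coordinate. *)
Definition momentum (m : set (borel M) -> \bar R) : 'rV[R]_n :=
  \row_i fine (\int[m]_x (mu x 0 i)%:E).

Definition polystable nu : Prop :=
  exists nu' : probability (borel M) R,
    measure_orbit nu nu' /\ momentum nu' = 0.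

Definition stable nu : Prop :=
  polystable nu /\
  exists (h : G) (l : set 'rV[R]_n), lie_subalgebra eK l /\
    Ad eG h @` lie_algebra_of eG (measure_stabilizer nu)
      = diota eK eG iota @` l.

End Measures.

(* Main.v *)
Require Import Defs.
From HB Require Import structures.
From mathcomp Require Import all_boot all_order all_algebra.
From mathcomp Require Import all_classical all_reals all_analysis.
From mathcomp Require Import measurable_realfun.
From mathcomp Require Import lra.
Import Order.TTheory GRing.Theory Num.Theory.
Import numFieldNormedType.Exports.
Set Implicit Arguments.
Unset Strict Implicit.
Unset Printing Implicit Defensive.
Local Open Scope classical_set_scope.
Local Open Scope ring_scope.

(** Why the theorem holds.  For h in G write F(h) for the momentum of h_* nu,
    read as a vector of R^n, and Phi(v) = F(exp(iv)) for v in Lie(K).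

    Polystability is obtained by a topological argument about the continuous
    field Phi on R^n, in place of the minimisation of a Kempf-Ness function.
    The curve t |-> exp(itw) x is a gradient line of mu^w, so mu^w does not
    decrease along it ([mu_flow_nondecreasing]), and for nu-almost every x it
    ends at the maximum of mu^w.  By dominated convergence the nondecreasing
    function t |-> <Phi(tw), w> tends to a positive multiple of a supremum that
    is positive because 0 is interior to the convex hull of the image of mu
    ([sup_mu_comp_gt0], [exists_mean_mu_flow_gt0]).  Monotonicity in t,
    continuity in w and compactness of the unit sphere turn this into
    <Phi(v), v> > 0 for all v outside some ball ([momentum_outward]), and a
    continuous field that points outwards off a ball has a zero
    ([zero_of_outward_field]).  This last fact has the strength of the theorem
    of Brouwer.  It is derived from the Poincare-Miranda theorem, and the
    latter from a parity count on a grid: a cup product of coboundaries with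
    coefficients in the field with two elements sums to 1 over the grid, by
    Stokes, hence is nonzero on some cell ([cup_box_odd]).

    Stability.  Let F(h) = 0 and let s stabilise nu.  In the polar decomposition
    h s h^-1 = k exp(iv), equivariance gives F(exp(iv) h) = 0.  The
    nondecreasing function t |-> <F(exp(itv) h), v> takes the value 0 at 0 and
    at 1, so mu^v is constant on the flow line from h x for almost every x; its
    gradient vanishes there, mu itself is constant on that line, and
    F(exp(itv) h) = 0 for every t ([momentum_geodesic]).  By [momentum_outward]
    all zeros of F lie in the image of K times a ball under the polar
    decomposition, so exp(itv) remains in a compact set, which forces v = 0
    ([bounded_geodesic]).  Thus h G_nu h^-1 lies in the image of K
    ([stabilizer_sub_K]).  Hence its Lie algebra comes from Lie(K), where it is
    the Lie algebra of a subgroup, and such a set is a Lie subalgebra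
    ([lie_subalgebra_of_subgroup]).

    Tangent vectors and Lie algebras being given in charts and by smooth curves,
    these arguments rest on the chain rule for maps of class C^k ([Ck_comp],
    [dmap_comp]). *)

(** * Cup products over the field with two elements *)

Section CupProduct.
Variables (I : finType) (T : Type) (e : I -> T -> T).
Hypothesis eC : forall i j x, e i (e j x) = e j (e i x).
Implicit Types (D : {set I}) (x : T).

(** The moves [e i] span a cube at each point [x].  Booleans with [addb] and
    [andb] form the field F_2, and [cup D [:: b1, b2 & _] x] is the value on
    that cube of the cup product db1 ... dbk of the coboundaries of the
    functions bj: a sum over the monotone paths from [x] in the directions of
    [D], i.e. over the simplices of the standard triangulation. *)
Fixpoint cup D (bs : seq (T -> bool)) x : bool :=
  if bs is b :: bs' then
    \big[addb/false]_(m in D) ((b (e m x) (+) b x) && cup (D :\ m) bs' (e m x))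
  else true.

Lemma exchange_pairs D (F : I -> I -> bool) :
  \big[addb/false]_(m in D) \big[addb/false]_(k in D :\ m) F m k =
  \big[addb/false]_(m in D) \big[addb/false]_(k in D :\ m) F k m.
Proof.
rewrite (exchange_big_dep [in D]) /=; last by move=> m k _; rewrite inE => /andP[].
apply: eq_bigr => k kD; apply: eq_bigl => m.
by rewrite !inE kD andbT andbC eq_sym.
Qed.

(** The terms at (m, k) and (k, m) cancel, the characteristic being 2. *)
Lemma sum_symmetric D (F : I -> I -> bool) : (forall m k, F m k = F k m) ->
  \big[addb/false]_(m in D) \big[addb/false]_(k in D :\ m) F m k = false.
Proof.
move=> FC.
pose lt (m k : I) := (enum_rank m < enum_rank k)%N.
have -> : \big[addb/false]_(m in D) \big[addb/false]_(k in D :\ m) F m k =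
  \big[addb/false]_(m in D) \big[addb/false]_(k in D :\ m)
     ((lt m k && F m k) (+) (lt k m && F m k)).
  apply: eq_bigr => m _; apply: eq_bigr => k; rewrite !inE => /andP[km _].
  rewrite /lt; case: ltngtP => //= [_|/ord_inj/enum_rank_inj kE].
  - by rewrite addbF.
  - by rewrite kE eqxx in km.
under eq_bigr => m _ do rewrite big_split /=.
rewrite big_split /= [X in _ (+) X]exchange_pairs.
rewrite -big_split /= big1// => m mD; rewrite -big_split /= big1// => k kD.
by rewrite FC addbb.
Qed.

(** A product of coboundaries is a cocycle.  Expanding the first factor, the
    terms symmetric in the pair of directions cancel, and the other ones are
    instances of the claim for the remaining factors. *)
Lemma cup_closed D bs x :
  \big[addb/false]_(m in D) (cup (D :\ m) bs (e m x) (+) cup (D :\ m) bs x)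
  = false.
Proof.
elim: bs D x => [|b bs IH] D x /=; first by rewrite big1.
pose C m k y := cup (D :\ m :\ k) bs y.
have CC m k y : C m k y = C k m y by rewrite /C !finset.setDDl finset.setUC.
pose S F := \big[addb/false]_(m in D) \big[addb/false]_(k in D :\ m) F m k.
have SD F H : S (fun m k => F m k (+) H m k) = S F (+) S H.
  by rewrite /S -big_split; apply: eq_bigr => m _; rewrite -big_split.
have IHS : S (fun m k => b (e m x) && (C m k (e k (e m x)) (+) C m k (e m x)))
    = false.
  rewrite /S big1// => m _; rewrite -big_distrr/= /C.
  by rewrite IH andbF.
have IHC : S (fun m k => C m k (e k (e m x)) (+) C m k (e m x)) = false.
  by rewrite /S big1// => m _; exact: IH.
transitivity (S (fun m k => (b (e k (e m x)) && C m k (e k (e m x))) (+)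
   (b (e m x) && C m k (e k (e m x))) (+) (b (e k x) && C m k (e k x)) (+)
   (b x && C m k (e k x)))).
  apply: eq_bigr => m _; rewrite -big_split; apply: eq_bigr => k _ /=.
  by rewrite /C !andb_addl !addbA.
rewrite !SD.
rewrite {1}/S sum_symmetric ?addFb; last by move=> m k; rewrite CC eC.
rewrite [X in _ (+) X (+) _]/S exchange_pairs.
rewrite -[X in _ (+) X (+) _]/(S (fun m k => b (e m x) && C k m (e m x))).
have -> : S (fun m k => b x && C m k (e k x)) = false.
  transitivity (b x && S (fun m k => C m k (e k x))).
    by rewrite /S big_distrr; apply: eq_bigr => m _; rewrite big_distrr.
  rewrite [S _]exchange_pairs; move: IHC; rewrite SD {1}/S sum_symmetric.
    rewrite addFb => SC0.
    rewrite (_ : bigop _ _ _ = false) ?andbF// -[RHS]SC0.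
    by apply: eq_bigr => m _; apply: eq_bigr => k _; rewrite CC.
  by move=> m k; rewrite CC eC.
rewrite addbF -SD -[RHS]IHS; apply: eq_bigr => m _; apply: eq_bigr => k _.
by rewrite (CC k m) andb_addr.
Qed.

End CupProduct.

(** * A sign-changing cell in a labelled grid *)
Section Grid.
Variables (n p : nat).
Let pt := {ffun 'I_n -> 'I_p.+1}.
Implicit Types (x y : pt) (i m : 'I_n) (D : {set 'I_n}).

Definition bump_at m x : pt :=
  [ffun i => if i == m then inord (x i).+1 else x i].

Lemma bump_atC i j x :
  bump_at i (bump_at j x) = bump_at j (bump_at i x).
Proof.
apply/ffunP => k; rewrite !ffunE.
by case: (k =P i) => [->|]; case: (_ =P j).
Qed.

(** The coordinates outside [D] are kept at the top value [p], so that the faces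
    met when directions are removed one at a time are again boxes. *)
Definition box D : pred pt :=
  [pred x : pt | [forall i, if i \in D then (x i < p)%N else (x i == p :> nat)]].

Definition low_face D m : pred pt :=
  [pred x : pt | [forall i, if i == m then (x i == 0%N :> nat) else
     if i \in D then (x i < p)%N else (x i == p :> nat)]].

(** Stokes in one direction: the sums of [f] over a box and over its translate
    differ by the two opposite faces. *)
Lemma sum_bump D m (f : pt -> bool) : m \in D ->
  \big[addb/false]_(x | box D x) (f (bump_at m x) (+) f x) =
  \big[addb/false]_(x | box (D :\ m) x) f x (+)
  \big[addb/false]_(x | low_face D m x) f x.
Proof.
move=> mD.
pose P x := [forall i, (i != m) ==>
  if i \in D then (x i < p)%N else (x i == p :> nat)].
have splitP (Q : 'I_n -> pred 'I_p.+1) (r : pred 'I_p.+1) x :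
    (forall i, Q i (x i) = if i == m then r (x i) else
      if i \in D then (x i < p)%N else (x i == p :> nat)) ->
    [forall i, Q i (x i)] = P x && r (x m).
  move=> QE; apply/forallP/andP => [h|[/forallP h rm] i].
    split; last by have := h m; rewrite QE eqxx.
    by apply/forallP => i; apply/implyP => im; move: (h i); rewrite QE (negbTE im).
  by rewrite QE; case: (i =P m) => [->//|/eqP im]; move: (h i); rewrite im.
have boxE x : box D x = P x && (x m < p)%N.
  rewrite [LHS](splitP (fun i (k : 'I_p.+1) =>
      if i \in D then (k < p)%N else (k == p :> nat))
    [pred k : 'I_p.+1 | (k < p)%N])// => i.
  by case: (i =P m) => // ->; rewrite mD.
have box'E x : box (D :\ m) x = P x && (x m == p :> nat).
  rewrite [LHS](splitP (fun i (k : 'I_p.+1) =>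
      if i \in D :\ m then (k < p)%N else (k == p :> nat))
    [pred k : 'I_p.+1 | k == p :> nat])// => i.
  by rewrite !inE; case: (i =P m).
have faceE x : low_face D m x = P x && (x m == 0%N :> nat).
  rewrite [LHS](splitP (fun i (k : 'I_p.+1) => if i == m then k == 0%N :> nat else
    if i \in D then (k < p)%N else (k == p :> nat))
    [pred k : 'I_p.+1 | k == 0%N :> nat])//.
rewrite big_split /=.
pose drop x : pt := [ffun i => if i == m then inord (x i).-1 else x i].
have -> : \big[addb/false]_(x | box D x) f (bump_at m x) =
    \big[addb/false]_(x | P x && (0 < x m)%N) f x.
  rewrite [RHS](reindex_onto (bump_at m) drop) /=; last first.
    move=> x /andP[_ xm]; apply/ffunP => i; rewrite !ffunE.
    case: (i =P m) => // ->; apply/val_inj.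
    have xm1 : ((x m).-1 < p.+1)%N := leq_ltn_trans (leq_pred _) (ltn_ord _).
    by rewrite /= (inordK xm1) prednK// inordK.
  apply: eq_bigl => x; rewrite boxE.
  have -> : P (bump_at m x) = P x.
    by apply: eq_forallb => i; rewrite !ffunE; case: (i =P m).
  rewrite -andbA; congr (_ && _); rewrite ffunE eqxx.
  have [xp|xp] := ltnP (x m) p.
    rewrite inordK ?ltnS//=; apply/esym/eqP/ffunP => i; rewrite !ffunE.
    case: (i =P m) => // ->; apply/val_inj; rewrite /= !inordK//=.
  have xE : (x m : nat) = p by apply/eqP; rewrite eqn_leq xp -ltnS ltn_ord.
  by rewrite xE /inord /insubd insubF//= ltnn.
transitivity (\big[addb/false]_(x | P x && (0 < x m)%N) f x (+)
  \big[addb/false]_(x | P x && (x m < p)%N) f x).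
  by congr (_ (+) _); apply: eq_bigl => x; rewrite boxE.
rewrite (eq_bigl _ _ box'E) (eq_bigl _ _ faceE).
have -> : \big[addb/false]_(x | P x && (0 < x m)%N) f x =
   \big[addb/false]_(x | P x) f x (+)
   \big[addb/false]_(x | P x && (x m == 0%N :> nat)) f x.
  rewrite (bigID (fun x => x m == 0%N :> nat) P)/= addbC addbA addbb addFb.
  by apply: eq_bigl => x; rewrite lt0n.
have -> : \big[addb/false]_(x | P x && (x m < p)%N) f x =
   \big[addb/false]_(x | P x) f x (+)
   \big[addb/false]_(x | P x && (x m == p :> nat)) f x.
  rewrite (bigID (fun x => x m == p :> nat) P)/= addbC addbA addbb addFb.
  apply: eq_bigl => x; congr (_ && _).
  by rewrite ltn_neqAle -ltnS ltn_ord andbT.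
by rewrite addbACA addbb addFb addbC.
Qed.

Variable a : 'I_n -> pt -> bool.
Hypothesis a_low : forall i x, x i = 0%N :> nat -> a i x = false.
Hypothesis a_high : forall i x, x i = p :> nat -> a i x = true.

Local Notation cup_at := (cup bump_at).

(** Inside a face where coordinate [m] is extremal the label [a m] is constant,
    so that its coboundary kills the cup product. *)
Lemma cup_face0 D (s : seq 'I_n) m x : m \in s -> m \notin D ->
  (x m == 0%N :> nat) || (x m == p :> nat) -> cup_at D (map a s) x = false.
Proof.
elim: s D x => //= i s IH D x; rewrite inE => ms mD xm; rewrite big1// => k kD.
have km : (m == k) = false by apply/eqP => mk; rewrite mk kD in mD.
have bm : bump_at k x m = x m by rewrite ffunE km.
case/predU1P: ms => [<-|ms].
  suff -> : a m (bump_at k x) = a m x by rewrite addbb.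
  case/orP: xm => /eqP xm; first by rewrite !a_low ?bm.
  by rewrite !a_high ?bm.
by rewrite IH ?andbF ?bm// !inE negb_and mD orbT.
Qed.

(** Since db1 db2 ... dbk is the coboundary of b1 db2 ... dbk, its sum over the
    box is a sum over the faces.  By the boundary conditions only the high face
    in the direction of b1 contributes, and there b1 = 1: this is the same
    statement in one dimension less. *)
Lemma cup_box_odd (s : seq 'I_n) : uniq s ->
  \big[addb/false]_(x | box [set i in s] x) cup_at [set i in s] (map a s) x
  = true.
Proof.
elim: s => [_|m s IH /= /andP[ms us]].
  rewrite (big_pred1 [ffun => ord_max])//= => x.
  apply/forallP/eqP => [h|-> i]; last by rewrite inE in_nil ffunE/=.
  by apply/ffunP => i; have := h i; rewrite inE in_nil ffunE => /eqP xi; exact: val_inj.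
set D := [set i in m :: s].
have Dm : D :\ m = [set i in s].
  by apply/setP => i; rewrite !inE; case: eqP => // ->; rewrite (negbTE ms).
pose F k x := a m x && cup_at (D :\ k) (map a s) x.
transitivity (\big[addb/false]_(k in D) \big[addb/false]_(x | box D x)
    (F k (bump_at k x) (+) F k x)).
  rewrite [RHS]exchange_big /=; apply: eq_bigr => x _.
  have := cup_closed bump_atC D (map a s) x => /(congr1 (andb (a m x))).
  rewrite andbF big_distrr/= => zero; rewrite -[LHS]addbF -[X in _ (+) X]zero.
  rewrite -big_split /=; apply: eq_bigr => k _; rewrite /F.
  by case: (a m _); case: (a m _); case: (cup _ _ _ _); case: (cup _ _ _ _).
rewrite (bigD1 m) ?inE ?eqxx//= [X in _ (+) X]big1 ?addbF; last first.
  move=> k /andP[kD km]; rewrite sum_bump//.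
  have ks : k \in s by move: kD; rewrite inE in_cons (negbTE km).
  rewrite !big1// => x /forallP/(_ k); rewrite ?eqxx ?inE ?eqxx/= => /eqP xk.
    by rewrite /F (cup_face0 ks) ?andbF ?xk ?eqxx// !inE eqxx.
  by rewrite /F (cup_face0 ks) ?andbF ?xk ?eqxx ?orbT// !inE eqxx.
rewrite sum_bump ?inE ?eqxx// [X in _ (+) X]big1 ?addbF; last first.
  by move=> x /forallP/(_ m); rewrite eqxx => /eqP xm; rewrite /F a_low.
rewrite -[RHS](IH us) -Dm; apply: eq_bigr => x /forallP/(_ m).
by rewrite !inE eqxx/= => /eqP xm; rewrite /F a_high.
Qed.

(** A nonzero cup product selects a path in the cell along which each label
    changes at some step. *)
Lemma cup_sign_change D (bs : seq (pt -> bool)) x b :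
  (forall i, i \in D -> (x i < p)%N) -> cup_at D bs x -> List.In b bs ->
  exists y z, b y != b z /\
    forall i, (x i <= y i <= (x i).+1)%N && (x i <= z i <= (x i).+1)%N /\
      (i \notin D -> y i = x i /\ z i = x i).
Proof.
elim: bs D x => //= c bs IH D x xD cx bbs.
have /existsP[m /and3P[mD cm cupm]] : [exists m, [&& m \in D,
    c (bump_at m x) (+) c x & cup_at (D :\ m) bs (bump_at m x)]].
  apply: contraLR cx => /existsPn h; rewrite big1// => m mD.
  by have := h m; rewrite mD /= => /negbTE.
have bm i : bump_at m x i = (x i + (i == m))%N :> nat.
  rewrite ffunE; case: eqP => [->|_]; last by rewrite addn0.
  by rewrite inordK ?addn1// ltnS xD.
case: bbs => [<-|bbs].
  exists (bump_at m x), x; split; first by case: (c _) cm; case: (c x).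
  move=> i; rewrite bm !leqnn leqnSn leq_addr/= -[X in (_ <= X)%N]addn1 leq_add2l leq_b1.
  split=> // iD; split=> //; rewrite ffunE; case: eqP => // im.
  by rewrite im mD in iD.
have [|y [z [byz h]]] := IH _ _ _ cupm bbs.
  move=> i; rewrite !inE => /andP[im iD]; rewrite bm (negbTE im) addn0 xD//.
exists y, z; split=> // i; have [h1 h2] := h i; split; last first.
  move=> iD; have im : i != m by apply: contraNneq iD => ->.
  have := h2; rewrite !inE negb_and iD orbT ffunE (negbTE im); exact.
have [im|im] := eqVneq i m.
  have := h2; rewrite im !inE eqxx/= => /(_ isT)[-> ->].
  by rewrite bm eqxx addn1 leqnn leqnSn.
by move: h1; rewrite bm (negbTE im) addn0.
Qed.

Lemma exists_sign_changing_cell : exists x : pt, forall i, exists y z,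
  a i y != a i z /\
  forall j, (x j <= y j <= (x j).+1)%N && (x j <= z j <= (x j).+1)%N.
Proof.
have := cup_box_odd (enum_uniq 'I_n).
rewrite (_ : [set i in _] = [set: 'I_n]%SET); last first.
  by apply/setP => i; rewrite !inE mem_enum.
move=> sumT.
have /existsP[x /andP[xb xc]] : [exists x : pt, box [set: 'I_n]%SET x &&
    cup_at [set: 'I_n]%SET (map a (enum 'I_n)) x].
  apply: contraPT sumT => /existsPn h; rewrite big1// => x xb.
  by have := h x; rewrite xb => /negbTE.
exists x => i.
have [||y [z [ayz h]]] := @cup_sign_change _ _ x (a i) _ xc.
- by move=> j _; have /forallP/(_ j) := xb; rewrite inE.
- have : i \in enum 'I_n by rewrite mem_enum.
  elim: (enum 'I_n) => //= j s IH; rewrite inE => /predU1P[->|/IH]; by [left|right].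
by exists y, z; split=> // j; have [] := h j.
Qed.

End Grid.
(** * Zeros of vector fields on R^n *)

Section RowVectors.
Context {R : realType} {n : nat}.
Implicit Types v w : 'rV[R]_n.

Lemma coord_le_norm v i : `|v 0 i| <= `|v|.
Proof.
rewrite [leRHS]/Num.Def.normr /= mx_normrE; apply/bigmax_geP; right => /=.
by exists (0, i); rewrite ?mem_index_enum.
Qed.

Lemma norm_le_coord v c : 0 <= c -> (forall i, `|v 0 i| <= c) -> `|v| <= c.
Proof.
move=> c0 h; rewrite [leLHS]/Num.Def.normr /= mx_normrE; apply/bigmax_leP; split=> //=.
by case=> i j _ /=; rewrite ord1.
Qed.

Lemma compact_norm_le c : compact [set v : 'rV[R]_n | `|v| <= c].
Proof.
apply: bounded_closed_compact.
  exists c; split; first exact: num_real.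
  by move=> a ca v /= vc; rewrite (le_trans vc)// ltW.
apply: (@closed_comp _ _ (fun v : 'rV[R]_n => `|v|) [set x : R | x <= c]).
  by move=> v _; exact: norm_continuous.
exact: closed_le.
Qed.

Lemma pairingE v w : pairing v w = \sum_i v 0 i * w 0 i.
Proof. by rewrite /pairing mxE; apply: eq_bigr => i _; rewrite mxE. Qed.

Lemma pairing_ge0 v : 0 <= pairing v v.
Proof. by rewrite pairingE sumr_ge0// => i _; rewrite -expr2 sqr_ge0. Qed.

Lemma pairing_gt0 v : v != 0 -> 0 < pairing v v.
Proof.
move=> v0; rewrite lt_neqAle pairing_ge0 andbT; apply: contra v0 => /eqP/esym.
rewrite pairingE => /psumr_eq0P h; apply/eqP/rowP => i; rewrite mxE.
have /eqP := h (fun i _ => ltac:(by rewrite -expr2 sqr_ge0)) i isT.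
by rewrite mulf_eq0 orbb => /eqP.
Qed.

Lemma pairingZl a v w : pairing (a *: v) w = a * pairing v w.
Proof. by rewrite !pairingE mulr_sumr; apply: eq_bigr => i _; rewrite mxE mulrA. Qed.

Lemma pairingZr a v w : pairing v (a *: w) = a * pairing v w.
Proof. by rewrite !pairingE mulr_sumr; apply: eq_bigr => i _; rewrite mxE mulrCA. Qed.

Lemma pairing0l w : pairing 0 w = 0.
Proof. by rewrite pairingE big1// => i _; rewrite mxE mul0r. Qed.

Lemma pairing_delta v i : pairing v (delta_mx 0 i) = v 0 i.
Proof.
rewrite pairingE (bigD1 i)//= mxE !eqxx mulr1 big1 ?addr0// => k ki.
by rewrite mxE (negbTE ki) andbF mulr0.
Qed.

Lemma rV_continuousP (T : topologicalType) (f : T -> 'rV[R]_n) :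
  (forall i, continuous (fun x => f x 0 i : R)) -> continuous f.
Proof.
move=> fi x; apply/cvgrPdist_le => e e0.
have h : \forall y \near x, forall i, `|f x 0 i - f y 0 i| <= e.
  apply: filter_forall => i; have /cvgrPdist_le := fi i x; exact.
apply: filterS h => y h; apply: norm_le_coord; first exact: ltW.
by move=> i; rewrite !mxE.
Qed.

End RowVectors.

Lemma continuous_pairing (R : realType) (n : nat) (T : topologicalType)
    (f h : T -> 'rV[R]_n) :
  continuous f -> continuous h -> continuous (fun z => pairing (f z) (h z) : R).
Proof.
move=> fc hc.
rewrite (_ : (fun z => _) = (fun z => \sum_i f z 0 i * h z 0 i)); last first.
  by apply/funext => z; rewrite pairingE.
apply: continuous_big; first exact: add_continuous.
move=> i _ z; apply: cvgM.
  by apply: (@continuous_comp _ _ _ f (fun u : 'rV[R]_n => u 0 i));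
    [exact: fc|exact: coord_continuous].
by apply: (@continuous_comp _ _ _ h (fun u : 'rV[R]_n => u 0 i));
  [exact: hc|exact: coord_continuous].
Qed.

Section PoincareMiranda.
Context {R : realType} {n : nat}.
Variables (H : 'rV[R]_n -> 'rV[R]_n) (L : R).
Hypotheses (L0 : 0 < L) (Hc : continuous H).
Hypothesis H_low : forall (v : 'rV[R]_n) i, `|v| <= L -> v 0 i = - L -> H v 0 i <= 0.
Hypothesis H_high : forall (v : 'rV[R]_n) i, `|v| <= L -> v 0 i = L -> 0 < H v 0 i.

(* p.+1 cells per direction subdivide the cube [-L, L]^n. *)
Let node p (x : {ffun 'I_n -> 'I_p.+2}) : 'rV[R]_n :=
  \row_i (- L + 2 * L * ((x i)%:R / p.+1%:R)).

Let node_norm p x : `|@node p x| <= L.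
Proof.
apply: norm_le_coord => [|i]; first exact: ltW.
rewrite mxE ler_norml; set r := _ / _.
have r0 : 0 <= r by rewrite divr_ge0.
have r1 : r <= 1 by rewrite ler_pdivrMr// mul1r ler_nat -ltnS ltn_ord.
have Lr : 0 <= L * r by rewrite mulr_ge0// ltW.
have Lr1 : L * r <= L by rewrite -[leRHS]mulr1 ler_pM2l.
by apply/andP; split; lra.
Qed.

Let exists_node p : exists v : 'rV[R]_n, `|v| <= L /\ forall i, exists w z : 'rV[R]_n,
  (forall j, `|v 0 j - w 0 j| <= 2 * L / p.+1%:R) /\
  (forall j, `|v 0 j - z 0 j| <= 2 * L / p.+1%:R) /\
  (0 < H w 0 i) /\ (H z 0 i <= 0).
Proof.
have p0 : (0 : R) < p.+1%:R by rewrite ltr0n.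
have [i x xi|i x xi|x hx] := @exists_sign_changing_cell n p.+1
  (fun i x => 0 < H (node x) 0 i).
- apply/negbTE; rewrite -leNgt; apply: H_low; first exact: node_norm.
  by rewrite mxE xi mul0r mulr0 addr0.
- apply: H_high; first exact: node_norm.
  by rewrite mxE xi divff ?gt_eqF// mulr1 mulr_natl mulr2n addKr.
exists (node x); split; first exact: node_norm.
have close (y : {ffun 'I_n -> 'I_p.+2}) j : (x j <= y j <= (x j).+1)%N ->
    `|node x 0 j - node y 0 j| <= 2 * L / p.+1%:R.
  move=> /andP[h1 h2]; rewrite !mxE opprD addrACA subrr add0r -mulrBr -mulrBl.
  rewrite mulrA normrM normfV (ger0_norm (ltW p0)) ler_wpM2r ?invr_ge0 ?(ltW p0)//.
  have L20 : 0 <= 2 * L by rewrite mulr_ge0// ltW.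
  rewrite normrM (ger0_norm L20) -[leRHS]mulr1 ler_wpM2l//.
  by rewrite distrC -natrB// normr_nat (ler_nat _ _ 1) leq_subLR addn1.
move=> i; have [y [z [yz h]]] := hx i.
have hy j : `|node x 0 j - node y 0 j| <= 2 * L / p.+1%:R.
  by apply: close; case/andP: (h j).
have hz j : `|node x 0 j - node z 0 j| <= 2 * L / p.+1%:R.
  by apply: close; case/andP: (h j).
case: (ltP 0 (H (node y) 0 i)) yz => Hy; case: (ltP 0 (H (node z) 0 i)) => Hz // _.
  by exists (node y), (node z).
by exists (node z), (node y).
Qed.

(** At a cluster point of the sign-changing cells of finer and finer grids every
    coordinate of [H] takes both signs arbitrarily close by, hence vanishes. *)
Lemma poincare_miranda : exists v, H v = 0.
Proof.
have [vk vkP] := choice exists_node.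
have Bc := @compact_norm_le R n L.
have vB : (vk @ \oo) [set v : 'rV[R]_n | `|v| <= L].
  by exists 0%N => // k _; case: (vkP k).
have [v [_ vcl]] := Bc (vk @ \oo) _ vB.
exists v; apply/rowP => i; rewrite mxE; apply/eqP/negP => /negP Hv0.
have /cvgrPdist_lt/(_ `|H v 0 i|) : (fun w => H w 0 i) x @[x --> v] --> H v 0 i.
  apply: (@continuous_comp _ _ _ H (fun w : 'rV[R]_n => w 0 i)); first exact: Hc.
  exact: coord_continuous.
rewrite normr_gt0 => /(_ Hv0)/nbhs_ballP[e /= e0 he].
have e20 : 0 < e / 2 by rewrite divr_gt0.
have [N _ hN] : \forall k \near \oo, 2 * L / k.+1%:R < e / 2.
  near=> k; rewrite ltr_pdivrMr// -ltr_pdivrMl//.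
  rewrite (@lt_trans _ _ k%:R)// ?ltr_nat//.
  by near: k; exact: nbhs_infty_gtr.
have [w [[k Nk <-] wv]] := vcl (vk @` [set k | (N <= k)%N]) (ball v (e / 2))
  (ex_intro2 _ _ N I (fun k Nk => ex_intro2 _ _ k Nk erefl)) (nbhsx_ballx _ _ e20).
have [_ /(_ i)[y [z [hy [hz [Hy Hz]]]]]] := vkP k.
have close (u : 'rV[R]_n) : (forall j, `|vk k 0 j - u 0 j| <= 2 * L / k.+1%:R) ->
    `|H v 0 i - H u 0 i| < `|H v 0 i|.
  move=> hu; apply: he; split=> // a b; rewrite ord1 /ball/=.
  have := wv.2 0 b; rewrite /ball/= => vb.
  rewrite (splitr e) -(subrK (vk k 0 b) (v 0 b)) -addrA (le_lt_trans (ler_normD _ _))//.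
  by rewrite ltrD// (le_lt_trans (hu b))// hN.
have := close _ hy; have := close _ hz.
rewrite !ltr_norml; case: (ltrgt0P (H v 0 i)) => // h; lra.
Unshelve. all: by end_near. Qed.

End PoincareMiranda.

(** Extend [F] from the ball of radius [T] by F (r v) + v - r v, where [r] is the
    radial retraction.  On a large cube the second part dominates the bounded
    first one, so that the Poincare-Miranda theorem yields a zero; outside the
    ball a zero would make F (r v) a nonpositive multiple of r v. *)
Lemma zero_of_outward_field (R : realType) (n : nat)
    (F : 'rV[R]_n -> 'rV[R]_n) (T : R) : 0 < T -> continuous F ->
  (forall v, T <= `|v| -> 0 < pairing (F v) v) -> exists v, F v = 0.
Proof.
move=> T0 Fc Fout.
pose s (v : 'rV[R]_n) := T / Num.max T `|v|.
have max0 v : 0 < Num.max T `|v : 'rV[R]_n| by rewrite lt_max T0.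
have s0 v : 0 < s v by rewrite divr_gt0.
have s1 v : s v <= 1 by rewrite ler_pdivrMr// mul1r le_max lexx.
have sc : continuous s.
  move=> v; apply: (@continuousM _ _ (cst T) (fun v => (Num.max T `|v|)^-1)).
    exact: cst_continuous.
  apply: (@continuousV _ _ (fun v : 'rV[R]_n => Num.max T `|v|)).
    by rewrite gt_eqF.
  apply: (@continuous_max _ _ (cst T) (fun v : 'rV[R]_n => `|v|)).
    exact: cst_continuous.
  exact: norm_continuous.
pose r v := s v *: v.
have rc : continuous r.
  by move=> v; apply: (@continuousZ _ _ _ s id v); [exact: sc|exact: cvg_id].
have Frc : continuous (F \o r).
  by move=> v; apply: continuous_comp; [exact: rc|exact: Fc].
have rT v : `|r v| <= T.
  rewrite normrZ (gtr0_norm (s0 v)) /s mulrAC ler_pdivrMr// ler_pM2l//.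
  by rewrite le_max lexx orbT.
have Bc := @compact_norm_le R n T.
have [C0 [_ FC0]] : bounded_set (F @` [set v | `|v| <= T]).
  apply: compact_bounded; apply: continuous_compact => //.
  exact: continuous_subspaceT.
pose C := Num.max 1 (C0 + 1).
have C_gt0 : 0 < C by rewrite lt_max ltr01.
have FC v : `|F (r v)| <= C.
  by apply: FC0; [rewrite lt_max ltrDl ltr01 orbT|exists (r v) => //; exact: rT].
pose L := T + C + 1.
have L0 : 0 < L by rewrite /L; lra.
(* (1 - s v) *: v is v - r v. *)
pose H v := F (r v) + (1 - s v) *: v.
have Hc : continuous H.
  move=> v; apply: (@continuousD _ _ _ (F \o r) (fun v => (1 - s v) *: v)).
    exact: Frc.
  apply: (@continuousZ _ _ _ (fun v => 1 - s v) id v); last exact: cvg_id.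
  apply: (@continuousB R R^o _ (cst 1) s); [exact: cst_continuous|exact: sc].
have sL (v : 'rV[R]_n) i : `|v| <= L -> `|v 0 i| = L -> (1 - s v) * L = C + 1.
  move=> vL viL; have vE : `|v| = L.
    by apply/eqP; rewrite eq_le vL -viL coord_le_norm.
  rewrite /s vE (max_idPr _) ?mulrBl ?mul1r ?divfK ?gt_eqF// /L; lra.
have [v i vL vi|v i vL vi|v Hv] := @poincare_miranda R n H L L0 Hc.
- have := sL v i vL; rewrite vi normrN gtr0_norm// => /(_ erefl) e.
  rewrite !mxE vi mulrN e.
  have := le_trans (coord_le_norm (F (r v)) i) (FC v); rewrite ler_norml; lra.
- have := sL v i vL; rewrite vi gtr0_norm// => /(_ erefl) e.
  rewrite !mxE vi e.
  have := le_trans (coord_le_norm (F (r v)) i) (FC v); rewrite ler_norml; lra.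
have [vT|vT] := leP `|v| T.
  exists v; move: Hv; rewrite /H /r /s (max_idPl vT) divff ?gt_eqF//.
  by rewrite scale1r subrr scale0r addr0.
have rvT : `|r v| = T.
  rewrite normrZ (gtr0_norm (s0 v)) /s (max_idPr (ltW vT)) divfK//.
  by rewrite gt_eqF// (lt_trans T0).
have := Fout (r v); rewrite rvT lexx => /(_ isT).
have -> : F (r v) = - (1 - s v) *: v.
  by apply/eqP; rewrite scaleNr -addr_eq0; apply/eqP.
rewrite pairingZl pairingZr ltNge mulNr oppr_le0.
case/negP; apply: mulr_ge0; first by rewrite subr_ge0 s1.
by apply: mulr_ge0; [exact: ltW (s0 v)|exact: pairing_ge0].
Qed.

(** * Maps of class C^k *)

(** Scaling as a bilinear map, the form in which its differential is available. *)
Definition rscale (R : realType) (W : normedModType R) (a : R^o) (w : W) : W :=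
  a *: w.

Lemma rscale_is_bilinear (R : realType) (W : normedModType R) :
  bilinear_for
    (GRing.Scale.Law.clone _ _ *:%R _) (GRing.Scale.Law.clone _ _ *:%R _)
    (@rscale R W).
Proof.
rewrite /rscale; split=> [u'|u] a x y /=.
- by rewrite scalerDl scalerA.
- by rewrite scalerDr !scalerA mulrC.
Qed.

HB.instance Definition _ (R : realType) (W : normedModType R) :=
  bilinear_isBilinear.Build R R^o W W _ _ (@rscale R W) (rscale_is_bilinear W).

Section Calculus.
Context {R : realType}.
Implicit Types V W : normedModType R.
Implicit Types E : normedModType R.

(** The first-order expansion of [f] at [x] is also one of [g]. *)
Lemma near_eq_diff V W (f g : V -> W) x : (\near x, f x = g x) ->
  differentiable f x -> differentiable g x.
Proof.
move=> fg df.
have gE : g \o shift x = cst (g x) + 'd f x +o_ 0 id.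
  have /eqaddoP h := diff_locally df.
  have fg0 : \forall z \near 0, f (z + x) = g (z + x).
    by move: fg; rewrite (near_shift 0 x)/= subr0.
  apply/eqaddoP => e e0; have := h e e0 => {}h.
  near=> z.
  have <- : (f \o shift x - (cst (f x) + 'd f x)) z =
     (g \o shift x - (cst (g x) + 'd f x)) z.
    rewrite /GRing.opp/= /GRing.add/= /cst/= (nbhs_singleton fg).
    congr (_ - _); by near: z.
  by near: z.
have dgE := diff_unique (diff_continuous df) gE.
apply/diff_locallyP; rewrite dgE; split=> //; exact: diff_continuous.
Unshelve. all: by end_near. Qed.

Lemma continuous_rscale W :
  continuous (fun p : (R^o * W)%type => rscale p.1 p.2).
Proof.
move=> p; apply: (@continuousZ _ _ _ (fun p : (R^o * W)%type => p.1 : R) snd).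
  exact: cvg_fst.
exact: cvg_snd.
Qed.

Lemma differentiable_scale V W (s : V -> R^o) (f : V -> W) x :
  differentiable s x -> differentiable f x ->
  differentiable (fun y => s y *: f y) x.
Proof.
move=> ds df.
apply: (@differentiable_comp _ _ _ _ (fun y => (s y, f y))
   (fun p => rscale p.1 p.2)); first exact: differentiable_pair.
exact/differentiable_bilin/continuous_rscale.
Qed.

Lemma derive_scale V W (s : V -> R^o) (f : V -> W) x v :
  differentiable s x -> differentiable f x ->
  'D_v (fun y => s y *: f y) x = s x *: 'D_v f x + 'D_v s x *: f x.
Proof.
move=> ds df.
rewrite !deriveE//; last exact: differentiable_scale.
rewrite (_ : (fun y => _) = (fun p => rscale p.1 p.2) \o (fun y => (s y, f y)))//.
rewrite diff_comp ?diff_pair//=.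
- by rewrite diff_bilin//=; exact: continuous_rscale.
- exact: differentiable_pair.
- exact/differentiable_bilin/continuous_rscale.
Qed.

Lemma derive_comp E V W (f : V -> W) (g : E -> V) x v :
  differentiable g x -> differentiable f (g x) ->
  'D_v (f \o g) x = 'D_('D_v g x) f (g x).
Proof.
move=> dg df; rewrite (deriveE v dg) (deriveE _ df).
by rewrite (deriveE v (differentiable_comp dg df)) diff_comp.
Qed.

Lemma derive_linear V W (f : V -> W) x : differentiable f x ->
  linear (fun v => 'D_v f x).
Proof. by move=> df a u v; rewrite !deriveE// linearP. Qed.

Lemma CkS V W k (U : set V) (f : V -> W) : Ck k.+1 U f -> Ck k U f.
Proof.
elim: k f => [|k IH] f [df Df].
  by move=> x Ux; apply: differentiable_continuous; exact: df.
by split=> // v; apply: IH; exact: Df.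
Qed.

(** The sets [A] need not be open: being of class C^k on a set is a condition on
    the germs of the map at the points of that set. *)
Lemma Ck_local V W k (U : set V) (f : V -> W) :
  (forall x, U x -> exists2 A : set V, A x & Ck k A f) -> Ck k U f.
Proof.
elim: k f => [|k IH] f loc /=.
  by move=> x /loc[A Ax]; exact.
split=> [x /loc[A Ax [+ _]]|v]; first exact.
by apply: IH => x /loc[A Ax [_ h]]; exists A => //; exact: h.
Qed.

Lemma Ck_sub V W k (A B : set V) (f : V -> W) : A `<=` B -> Ck k B f -> Ck k A f.
Proof. by move=> AB fB; apply: Ck_local => x /AB Bx; exists B. Qed.

Lemma Ck_eq V W k (U : set V) (f g : V -> W) : open U ->
  (forall x, U x -> f x = g x) -> Ck k U f -> Ck k U g.
Proof.
move=> Uo; elim: k f g => [|k IH] f g fg /=.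
  move=> fc x Ux; have fgx : {near x, f =1 g}.
    by apply: filterS (open_nbhs_nbhs (conj Uo Ux)) => y; exact: fg.
  rewrite /prop_for /continuous_at -(fg x Ux).
  by apply: cvg_trans (fc x Ux); apply: near_eq_cvg; apply: filterS fgx => y ->.
move=> [df Df].
have fgx x : U x -> {near x, f =1 g}.
  by move=> Ux; apply: filterS (open_nbhs_nbhs (conj Uo Ux)) => y; exact: fg.
split=> [x Ux|v]; first exact: near_eq_diff (fgx x Ux) (df x Ux).
by apply: IH (Df v) => x Ux; apply: near_eq_derive; exact: fgx.
Qed.

Lemma Ck_cst V W k (U : set V) (a : W) : Ck k U (cst a).
Proof.
elim: k a => [|k IH] a /=; first by move=> x _; exact: cst_continuous.
split=> [x _|v]; first exact: differentiable_cst.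
have -> : 'D_v (cst a) = cst (0 : W) :> (V -> W); last exact: IH.
by apply/funext => x; rewrite derive_cst.
Qed.

Lemma Ck_id V k (U : set V) : Ck k U (fun x : V => x).
Proof.
case: k => [|k] /=; first by move=> x _; exact: cvg_id.
split=> [x _|v]; first exact: (@ex_diff _ _ _ _ _ _ _ (is_diff_id x)).
have -> : 'D_v (fun x : V => x) = cst v :> (V -> V); last exact: Ck_cst.
by apply/funext => x; rewrite derive_id.
Qed.

Lemma CkD V W k (U : set V) (f g : V -> W) : open U ->
  Ck k U f -> Ck k U g -> Ck k U (fun x => f x + g x).
Proof.
move=> Uo; elim: k f g => [|k IH] f g /=.
  by move=> fc gc x Ux; apply: continuousD; [exact: fc|exact: gc].
move=> [df Df] [dg Dg]; split=> [x Ux|v].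
  by apply: differentiableD; [exact: df|exact: dg].
apply: (Ck_eq Uo _ (IH _ _ (Df v) (Dg v))) => x Ux.
by rewrite [RHS]deriveD//; apply: diff_derivable; [exact: df|exact: dg].
Qed.

Lemma Ck_sum V W k (U : set V) (I : finType) (f : I -> V -> W) : open U ->
  (forall i, Ck k U (f i)) -> Ck k U (fun x => \sum_i f i x).
Proof.
move=> Uo fk; rewrite (_ : (fun x => _) = \sum_i f i); last first.
  by apply/funext => x; rewrite fct_sumE.
elim/big_ind: _ => //; first exact: Ck_cst.
by move=> a b; exact: CkD.
Qed.

Lemma Ck_scale V W k (U : set V) (s : V -> R^o) (f : V -> W) : open U ->
  Ck k U s -> Ck k U f -> Ck k U (fun x => s x *: f x).
Proof.
move=> Uo; elim: k s f => [|k IH] s f /=.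
  move=> sc fc x Ux; apply: (@continuousZ _ _ _ s f); [exact: sc|exact: fc].
move=> [ds Ds] [df Df]; split=> [x Ux|v].
  by apply: differentiable_scale; [exact: ds|exact: df].
apply: (@Ck_eq _ _ _ _ (fun x => s x *: 'D_v f x + 'D_v s x *: f x)) => //.
  by move=> x Ux; rewrite derive_scale//; [exact: ds|exact: df].
by apply: CkD => //; apply: IH => //; apply: CkS; split.
Qed.

Lemma Ck_pair V W W' k (U : set V) (f : V -> W) (g : V -> W') : open U ->
  Ck k U f -> Ck k U g -> Ck k U (fun x => (f x, g x)).
Proof.
move=> Uo; elim: k f g => [|k IH] f g /=.
  by move=> fc gc x Ux; apply: cvg_pair; [exact: fc|exact: gc].
move=> [df Df] [dg Dg]; split=> [x Ux|v].
  by apply: differentiable_pair; [exact: df|exact: dg].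
apply: (Ck_eq Uo _ (IH _ _ (Df v) (Dg v))) => x Ux.
have [dfx dgx] := (df x Ux, dg x Ux).
rewrite (deriveE v (differentiable_pair dfx dgx)) diff_pair//.
by rewrite (deriveE v dfx) (deriveE v dgx).
Qed.

Lemma Ck_linear V W W' k (U : set V) (f : V -> W) (l : {linear W -> W'}) :
  open U -> continuous l -> Ck k U f -> Ck k U (l \o f).
Proof.
move=> Uo lc; elim: k f => [|k IH] f /=.
  by move=> fc x Ux; apply: continuous_comp; [exact: fc|exact: lc].
move=> [df Df]; split=> [x Ux|v].
  by apply: differentiable_comp; [exact: df|exact: linear_differentiable].
apply: (Ck_eq Uo _ (IH _ (Df v))) => x Ux.
have dfx := df x Ux; have dl : differentiable l (f x).
  exact: linear_differentiable.
rewrite [LHS]/= (deriveE v dfx) (deriveE v (differentiable_comp dfx dl)).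
by rewrite (diff_comp dfx dl)/= diff_lin.
Qed.

Lemma Ck_coord V n k (U : set V) (f : V -> 'rV[R]_n) i : open U ->
  Ck k U f -> Ck k U (fun x => f x 0 i : R^o).
Proof.
have lin : linear (fun w : 'rV[R]_n => w 0 i : R^o).
  by move=> a u v; rewrite !mxE.
pose l : {linear 'rV[R]_n -> R^o} :=
  HB.pack (fun w : 'rV[R]_n => w 0 i : R^o) (GRing.isLinear.Build _ _ _ _ _ lin).
move=> Uo fk; apply: (@Ck_linear _ _ _ k U f l) => //.
exact: coord_continuous.
Qed.

(** A finite basis whose coordinate functions preserve the class C^k.  The chain
    rule needs it: the class C^k only speaks of derivatives in fixed directions,
    and 'D_(w x) f must be expanded along such directions when [w] varies. *)
Definition smooth_basis V := exists (I : finType) (e : I -> V) (c : I -> V -> R^o),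
  (forall i V' k (U : set V') (f : V' -> V), open U -> Ck k U f ->
     Ck k U (c i \o f)) /\
  forall v, v = \sum_i c i v *: e i.

Lemma smooth_basis_rV n : smooth_basis 'rV[R]_n.
Proof.
exists 'I_n, (delta_mx 0), (fun i (v : 'rV[R]_n) => v 0 i).
split; last exact: row_sum_delta.
move=> i V' k U f; exact: Ck_coord.
Qed.

Lemma smooth_basis_R : smooth_basis (R^o : normedModType R).
Proof.
exists 'I_1, (fun=> 1), (fun=> id); split=> // v.
by rewrite big_ord1 [RHS]mulr1.
Qed.

Lemma smooth_basis_prod V W : smooth_basis V -> smooth_basis W ->
  smooth_basis (V * W)%type.
Proof.
move=> [I [e [c [ck ce]]]] [I' [e' [c' [ck' ce']]]].
exists (I + I')%type, (fun i => match i with inl i => (e i, 0) | inr i => (0, e' i) end),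
  (fun i p => match i with inl i => c i p.1 | inr i => c' i p.2 end); split.
  move=> [i|i] V' k U f Uo fk.
    apply: (ck i _ _ _ (fst \o f)) => //; apply: Ck_linear => // p.
    exact: cvg_fst.
  apply: (ck' i _ _ _ (snd \o f)) => //; apply: Ck_linear => // p.
  exact: cvg_snd.
case=> v w; rewrite big_sumType/= [LHS]surjective_pairing/=.
apply: injective_projections => /=.
  rewrite !(raddf_sum fst)/= [X in _ + X]big1 ?addr0//.
  by move=> i _; rewrite /= scaler0.
rewrite !(raddf_sum snd)/= [X in X + _]big1 ?add0r//.
by move=> i _; rewrite /= scaler0.
Qed.

(** By induction on [k]: the derivative of f o g in the direction [v] is the sum
    over the basis of the coordinates of 'D_v g times ('D_(e i) f) o g. *)
Lemma Ck_comp E V W k (A : set E) (B : set V) (f : V -> W) (g : E -> V) :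
  smooth_basis V -> open A -> (forall x, A x -> B (g x)) ->
  Ck k A g -> Ck k B f -> Ck k A (f \o g).
Proof.
move=> [I [e [c [ck ce]]]] Ao AB; elim: k f => [|k IH] f.
  move=> gc fc x Ax; apply: continuous_comp; first exact: gc.
  exact/fc/AB.
move=> gk [df Df]; have [dg Dg] := gk; split=> [x Ax|v].
  by apply: differentiable_comp; [exact: dg|exact/df/AB].
apply: (@Ck_eq _ _ _ _
  (fun x => \sum_i (c i \o 'D_v g) x *: ('D_(e i) f \o g) x)) => //.
  move=> x Ax; rewrite derive_comp; [|exact: dg|exact/df/AB].
  rewrite [in RHS](ce ('D_v g x)) deriveE; last exact/df/AB.
  rewrite linear_sum; apply: eq_bigr => i _.
  by rewrite linearZ/= (deriveE (e i) (df _ (AB _ Ax))).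
apply: Ck_sum => // i; apply: Ck_scale => //; first by apply: ck => //; exact: Dg.
by apply: IH; [exact: CkS gk|exact: Df].
Qed.

End Calculus.

(** * Charts and smooth maps *)

Lemma openX (M N : topologicalType) (A : set M) (B : set N) :
  open A -> open B -> open (A `*` B).
Proof.
move=> Ao Bo; rewrite (_ : A `*` B = (fst @^-1` A) `&` (snd @^-1` B))//.
by apply: openI; apply: open_comp => // x _; [exact: cvg_fst|exact: cvg_snd].
Qed.

Lemma continuous_pair (M N P : topologicalType) (f : P -> M) (g : P -> N) :
  continuous f -> continuous g -> continuous (fun x => (f x, g x)).
Proof. by move=> fc gc x; apply: cvg_pair; [exact: fc|exact: gc]. Qed.

Lemma continuous_pairl (M N : topologicalType) (a : M) :
  continuous (fun y : N => (a, y)).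
Proof.
by apply: continuous_pair => y; [exact: cst_continuous|exact: cvg_id].
Qed.

(** The part of the axioms of a manifold that concerns each chart separately; it
    passes to products at no cost and suffices for the chain rule. *)
Record charted (R : realType) (V : normedModType R) (M : topologicalType)
    (A : atlas V M) : Prop := Charted {
  charted_cover : forall x, exists i, cdom A i x;
  charted_open_cdom : forall i, open (cdom A i);
  charted_open_image : forall i, open (chart A i @` cdom A i);
  charted_chartK : forall i x, cdom A i x -> cinv A i (chart A i x) = x;
  charted_cinv_cont :
    forall i x, cdom A i x -> {for chart A i x, continuous (cinv A i)} }.

Lemma manifold_charted (R : realType) (V : normedModType R)
  (M : topologicalType) (A : atlas V M) : manifold A -> charted A.
Proof. by case=> *; split. Qed.

Lemma charted_triv (R : realType) (V : normedModType R) :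
  charted (triv_atlas V).
Proof.
split=> /=; first by move=> x; exists tt.
- by move=> _; exact: openT.
- by move=> _; rewrite image_id; exact: openT.
- by [].
- by move=> _ x _; exact: cvg_id.
Qed.

Lemma charted_prod (R : realType) (V W : normedModType R)
    (M N : topologicalType) (A : atlas V M) (B : atlas W N) :
  charted A -> charted B -> charted (prod_atlas A B).
Proof.
move=> cA cB; split=> /=.
- move=> [x y]; have [i ix] := charted_cover cA x.
  by have [j jy] := charted_cover cB y; exists (i, j).
- move=> [i j]; exact: openX (charted_open_cdom cA i) (charted_open_cdom cB j).
- move=> [i j] /=.
  rewrite (_ : _ @` _ = (chart A i @` cdom A i) `*` (chart B j @` cdom B j)).
    exact: openX (charted_open_image cA i) (charted_open_image cB j).
  apply/seteqP; split=> [_ [[x y] [/= Ax By] <-]|[_ _] [/= [x Ax <-] [y By <-]]].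
    by split=> /=; [exists x|exists y].
  by exists (x, y).
- by move=> [i j] [x y] [/= /(charted_chartK cA) -> /(charted_chartK cB) ->].
- move=> [i j] [x y] [/= Ax By]; apply: cvg_pair.
    apply: (@continuous_comp _ _ _ fst (cinv A i)); first exact: cvg_fst.
    exact: charted_cinv_cont.
  apply: (@continuous_comp _ _ _ snd (cinv B j)); first exact: cvg_snd.
  exact: charted_cinv_cont.
Qed.

Section OneMap.
Context {R : realType} {V W : normedModType R} {M N : topologicalType}.
Variables (A : atlas V M) (B : atlas W N).
Hypothesis (cA : charted A).
Implicit Types (i : ix A) (j : ix B).

Lemma open_chart_image i (O : set M) : open O ->
  open (chart A i @` (cdom A i `&` O)).
Proof.
move=> Oo; rewrite openE => _ [x [Ax Ox] <-].
have h2 : \forall y \near chart A i x, (chart A i @` cdom A i) y.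
  by apply: open_nbhs_nbhs; split; [exact: charted_open_image|exists x].
have h3 : \forall y \near chart A i x, O (cinv A i y).
  apply: (charted_cinv_cont cA Ax); rewrite charted_chartK//.
  exact: open_nbhs_nbhs.
rewrite /interior; near=> y.
have [x' Ax' x'y] : (chart A i @` cdom A i) y by near: y.
exists x' => //; split=> //; rewrite -(charted_chartK cA Ax') x'y.
by near: y.
Unshelve. all: by end_near. Qed.

Lemma smooth_differentiable (f : M -> N) i j x : smooth_map A B f ->
  cdom A i x -> cdom B j (f x) -> differentiable (loc f i j) (chart A i x).
Proof. by move=> [_ /(_ i j 1%N) [h _]] Ax Bfx; apply: h; exists x. Qed.

Lemma near_chart i x (O : set M) : cdom A i x -> open O -> O x ->
  \forall y \near chart A i x, (chart A i @` (cdom A i `&` O)) y.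
Proof.
by move=> Ax Oo Ox; apply: open_nbhs_nbhs; split;
  [exact: open_chart_image|exists x].
Qed.

Lemma dmap_linear (f : M -> N) i j x : smooth_map A B f ->
  cdom A i x -> cdom B j (f x) -> linear (dmap f i j x).
Proof. by move=> sf Ax Bfx; apply/derive_linear/smooth_differentiable. Qed.

Lemma smooth_cst (b : N) : smooth_map A B (fun=> b).
Proof.
split; first by move=> x; exact: cst_continuous.
by move=> i j k; exact: Ck_cst.
Qed.

Lemma dmap_cst (b : N) i j x u : dmap (fun=> b) i j x u = 0.
Proof. exact: derive_cst. Qed.

Lemma dmap_id i x u : cdom A i x -> dmap idfun i i x u = u.
Proof.
move=> Ax; rewrite /dmap -[RHS](derive_id (chart A i x) u).
apply: near_eq_derive; have := near_chart Ax openT I.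
by apply: filterS => _ [y [Ay _] <-]; rewrite /loc/= charted_chartK.
Qed.

End OneMap.

Section SmoothMaps.
Context {R : realType} {V W E : normedModType R} {M N P : topologicalType}.
Variables (A : atlas V M) (B : atlas W N) (C : atlas E P).
Hypotheses (cA : charted A) (cB : charted B) (cC : charted C).
Implicit Types (i : ix A) (j : ix B) (k : ix C).

Lemma loc_comp (f : N -> P) (g : M -> N) i j k y :
  (chart A i @` (cdom A i `&` g @^-1` cdom B j)) y ->
  loc (f \o g) i k y = loc f j k (loc g i j y).
Proof.
move=> [x [Ax Bgx] <-]; rewrite /loc/= charted_chartK//.
by rewrite (charted_chartK cB).
Qed.

(** The chain rule: near the point, f o g read in the outer charts is the
    composite of the local expressions through the middle chart. *)
Lemma dmap_comp (f : N -> P) (g : M -> N) i j k x u :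
  smooth_map A B g -> smooth_map B C f ->
  cdom A i x -> cdom B j (g x) -> cdom C k (f (g x)) ->
  dmap (f \o g) i k x u = dmap f j k (g x) (dmap g i j x u).
Proof.
move=> sg sf Ax Bgx Cfgx; rewrite /dmap.
have locgx : loc g i j (chart A i x) = chart B j (g x).
  by rewrite /loc/= charted_chartK.
rewrite -locgx -derive_comp ?locgx; try exact: smooth_differentiable.
apply: near_eq_derive.
have : \forall y \near chart A i x,
    (chart A i @` (cdom A i `&` g @^-1` cdom B j)) y.
  apply: near_chart => //; apply: open_comp => [y _|]; first exact: sg.1.
  exact: charted_open_cdom.
by apply: filterS => y; exact: loc_comp.
Qed.

(** The middle chart depends on the point, so the class C^k is checked locally. *)
Lemma smooth_comp (f : N -> P) (g : M -> N) : smooth_basis W ->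
  smooth_map A B g -> smooth_map B C f -> smooth_map A C (f \o g).
Proof.
move=> bW [gc gs] [fc fs]; split.
  by move=> x; apply: continuous_comp; [exact: gc|exact: fc].
move=> i k m; apply: Ck_local => _ [x [Ax Cfgx] <-].
have [j Bgx] := charted_cover cB (g x).
pose O := (g @^-1` cdom B j) `&` ((f \o g) @^-1` cdom C k).
have Oo : open O.
  apply: openI; apply: open_comp => [y _|].
  - exact: gc.
  - exact: charted_open_cdom.
  - by apply: continuous_comp; [exact: gc|exact: fc].
  - exact: charted_open_cdom.
exists (chart A i @` (cdom A i `&` O)); first by exists x.
have Do : open (chart A i @` (cdom A i `&` O)) by exact: open_chart_image.
apply: (@Ck_eq _ _ _ _ _ (loc f j k \o loc g i j)) => //.
  move=> _ [y [Ay [Bgy Cfgy]] <-]; by rewrite (@loc_comp _ _ _ j)//; exists y.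
apply: (Ck_comp bW Do _ (Ck_sub _ (gs i j m)) (fs j k m)).
  move=> _ [y [Ay [Bgy Cfgy]] <-]; exists (g y) => //.
  by rewrite /loc/= charted_chartK.
by move=> _ [y [Ay [Bgy Cfgy]] <-]; exists y.
Qed.

Lemma smooth_pair (f : M -> N) (g : M -> P) :
  smooth_map A B f -> smooth_map A C g ->
  smooth_map A (prod_atlas B C) (fun x => (f x, g x)).
Proof.
move=> [fc fs] [gc gs]; split.
  by move=> x; apply: cvg_pair; [exact: fc|exact: gc].
move=> i [j k] m; apply: (@Ck_pair _ _ _ _ _ _ (loc f i j) (loc g i k)).
- apply: (open_chart_image cA); apply: open_comp => [x _|].
    by apply: cvg_pair; [exact: fc|exact: gc].
  exact: openX (charted_open_cdom cB j) (charted_open_cdom cC k).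
- by apply: Ck_sub (fs i j m) => _ [x [Ax [Bfx Cgx]] <-]; exists x.
- by apply: Ck_sub (gs i k m) => _ [x [Ax [Bfx Cgx]] <-]; exists x.
Qed.

Lemma dmap_pair (f : M -> N) (g : M -> P) i j k x u :
  smooth_map A B f -> smooth_map A C g ->
  cdom A i x -> cdom B j (f x) -> cdom C k (g x) ->
  @dmap _ _ _ _ _ A (prod_atlas B C) (fun x => (f x, g x)) i (j, k) x u =
  (dmap f i j x u, dmap g i k x u).
Proof.
move=> sf sg Ax Bfx Cgx; rewrite /dmap.
have df := smooth_differentiable sf Ax Bfx.
have dg : differentiable (loc g i k) (chart A i x).
  exact: smooth_differentiable.
rewrite (deriveE u df) (deriveE u dg).
rewrite -[LHS]/('D_u (fun y => (loc f i j y, loc g i k y)) (chart A i x)).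
by rewrite (deriveE u (differentiable_pair df dg)) diff_pair.
Qed.

End SmoothMaps.

(** In charts the projection is a change of charts after a linear projection. *)
Lemma smooth_fst (R : realType) (V W : normedModType R) (M N : topologicalType)
    (A : atlas V M) (B : atlas W N) : smooth_basis V -> manifold A ->
  charted B -> smooth_map (prod_atlas A B) A fst.
Proof.
move=> bV mA cB; have cA := manifold_charted mA.
split; first by move=> x; exact: cvg_fst.
move=> [i i'] j k.
have -> : @loc _ _ _ _ _ (prod_atlas A B) A fst (i, i') j = loc idfun i j \o fst by [].
have fstk U : open U -> Ck k U (fst : V * W -> V).
  move=> Uo; apply: (@Ck_linear _ _ _ _ _ _ (fun x => x) fst) => //.
    by move=> x; exact: cvg_fst.
  exact: Ck_id.
have [_ /(_ i j k) idk] := manifold_transition mA.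
apply: (Ck_comp bV _ _ (fstk _ _) idk).
- apply: open_chart_image; first exact: charted_prod.
  apply: open_comp => [x _|]; first exact: cvg_fst.
  exact: charted_open_cdom.
- by move=> _ [[x y] [[/= Ax By] Ajx] <-]; exists x.
- apply: open_chart_image; first exact: charted_prod.
  apply: open_comp => [x _|]; first exact: cvg_fst.
  exact: charted_open_cdom.
Qed.

(** * Lie groups and their subgroups *)

Lemma linear_rV_smooth (R : realType) (n k : nat) (W : normedModType R)
  (l : {linear 'rV[R]_n -> W}) : Ck k setT l.
Proof.
apply: (@Ck_eq _ _ _ _ _ (fun u : 'rV[R]_n => \sum_i u 0 i *: l (delta_mx 0 i))).
- exact: openT.
- move=> u _; rewrite [in RHS](row_sum_delta u) linear_sum.
  by apply: eq_bigr => i _; rewrite linearZ.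
- apply: Ck_sum => [|i]; first exact: openT.
  apply: Ck_scale; [exact: openT| |exact: Ck_cst].
  by apply: Ck_coord; [exact: openT|exact: Ck_id].
Qed.

Lemma linear_rV_continuous (R : realType) (n : nat) (W : normedModType R)
  (l : {linear 'rV[R]_n -> W}) : continuous l.
Proof. by move=> u; exact: (@linear_rV_smooth _ _ 0%N _ l). Qed.

(** The subspace is the row space of a matrix of maximal rank with rows in it. *)
Lemma subspace_kernel (R : realType) (n : nat) (l : set 'rV[R]_n) :
  l 0 -> (forall a u v, l u -> l v -> l (a *: u + v)) ->
  exists A : 'M[R]_n, forall u, l u <-> u *m A = 0.
Proof.
move=> l0 lin.
have lsum (I : Type) (s : seq I) (a : I -> R) (f : I -> 'rV[R]_n) :
    (forall i, l (f i)) -> l (\sum_(i <- s) a i *: f i).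
  move=> lf; elim: s => [|i s IH]; first by rewrite big_nil.
  by rewrite big_cons; exact: lin.
pose P r := `[< exists m (B : 'M[R]_(m, n)), (forall i, l (row i B)) /\ \rank B = r >].
have P0 : exists r, P r.
  exists 0%N; apply/asboolP; exists 0%N, 0; split; first by case.
  by rewrite mxrank0.
have Pn r : P r -> (r <= n)%N.
  by move=> /asboolP[m [B [_ <-]]]; exact: rank_leq_col.
case: (ex_maxnP P0 Pn) => r /asboolP[m [B [lB rB]]] maxr.
exists (cokermx B) => u; split=> [lu|/eqP].
  apply/eqP; rewrite -submxE.
  have Bsub : (B <= col_mx u B)%MS by rewrite -addsmxE addsmxSr.
  have : \rank (col_mx u B) == \rank B.
    rewrite eqn_leq (mxrankS Bsub) andbT rB; apply: maxr; apply/asboolP.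
    exists (1 + m)%N, (col_mx u B); split=> // i.
    rewrite -(splitK i); case: (fintype.split i) => k /=.
      by rewrite rowKu ord1 row_id.
    by rewrite rowKd.
  rewrite eq_sym (mxrank_leqif_sup Bsub); apply: submx_trans.
  by rewrite -addsmxE addsmxSl.
rewrite -submxE => /submxP[w ->]; rewrite mulmx_sum_row.
exact: lsum.
Qed.

(** A subspace of R^n is the kernel of a continuous linear map, which therefore
    also kills the velocity of the curve. *)
Lemma derive_in_subspace (R : realType) (n : nat) (l : set 'rV[R]_n)
    (c : R^o -> 'rV[R]_n) :
  l 0 -> (forall a u v, l u -> l v -> l (a *: u + v)) ->
  differentiable c 0 -> (\forall t \near 0, l (c t)) -> l ('D_1 c 0).
Proof.
move=> l0 lin dc lc; have [A lA] := subspace_kernel l0 lin.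
apply/lA; pose f : {linear 'rV[R]_n -> 'rV[R]_n} := mulmxr A.
have fc : continuous f by exact: linear_rV_continuous.
have df : differentiable f (c 0) by exact: linear_differentiable.
have : 'D_1 (f \o c) 0 = 0.
  rewrite -[RHS](derive_cst (0 : 'rV[R]_n) (0 : R^o) 1).
  by apply: near_eq_derive; apply: filterS lc => t /lA.
by rewrite derive_comp// deriveE// diff_lin.
Qed.

Section LieGroup.
Context {R : realType} {V : normedModType R} {G : topGroupType}.
Variables (A : atlas V G) (e : ix A).
Hypotheses (LG : lie_group e) (bV : smooth_basis V).

Let T : atlas (R^o : normedModType R) R^o := triv_atlas (R^o : normedModType R).
Let mA : manifold A := lie_manifold LG.
Let cA : charted A := manifold_charted mA.
Let cAA : charted (prod_atlas A A) := charted_prod cA cA.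
Let cT : charted T := charted_triv _.
Let bVV : smooth_basis (V * V)%type := smooth_basis_prod bV bV.
Let e1 : cdom A e 1%g := lie_chart1 LG.
Let e1' (x : G) : x = 1%g -> cdom A e x. Proof. by move=> ->. Qed.

Lemma smooth_conj_pair :
  smooth_map (prod_atlas A A) A (fun p : G * G => (p.1 * p.2 * p.1^-1)%g).
Proof.
pose f (p : G * G) : G * G := ((p.1 * p.2)%g, (p.1^-1)%g).
have sf : smooth_map (prod_atlas A A) (prod_atlas A A) f.
  apply: smooth_pair => //; first exact: lie_mul LG.
  by apply: (smooth_comp cAA cA cA bV (smooth_fst bV mA cA)); exact: lie_inv LG.
exact: (smooth_comp cAA cAA cA bVV sf (lie_mul LG)).
Qed.

Lemma smooth_conj (h : G) : smooth_map A A (fun x => (h * x * h^-1)%g).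
Proof.
pose f (x : G) : G * G := (h, x).
have sf : smooth_map A (prod_atlas A A) f.
  by apply: smooth_pair => //; [exact: smooth_cst|exact: manifold_transition].
exact: (smooth_comp cA cAA cA bVV sf smooth_conj_pair).
Qed.

Lemma smooth_curve_mul (c1 c2 : R -> G) : smooth_curve A c1 -> smooth_curve A c2 ->
  smooth_curve A (fun t => c1 t * c2 t)%g.
Proof.
move=> s1 s2.
exact: (smooth_comp cT cAA cA bVV (smooth_pair cT cA cA s1 s2) (lie_mul LG)).
Qed.

Lemma smooth_curve_conj (h : G) (c : R -> G) : smooth_curve A c ->
  smooth_curve A (fun t => h * c t * h^-1)%g.
Proof. by move=> sc; exact: (smooth_comp cT cA cA bV sc (smooth_conj h)). Qed.

Lemma smooth_curve_cst (h : G) : smooth_curve A (fun=> h).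
Proof. exact: smooth_cst. Qed.

Lemma velocity_cst (h : G) : velocity e (fun=> h) = 0.
Proof. exact: derive_cst. Qed.

Lemma velocity_conj (h : G) (c : R -> G) : smooth_curve A c -> c 0 = 1%g ->
  velocity e (fun t => h * c t * h^-1)%g = Ad e h (velocity e c).
Proof.
move=> sc c0.
have hx : cdom A e (h * c 0 * h^-1)%g by apply: e1'; rewrite c0 mulg1 mulgV.
have := @dmap_comp _ _ _ _ _ _ _ T A A cT cA (fun x => (h * x * h^-1)%g) c tt e e
   0 1 sc (smooth_conj h) I (e1' c0) hx.
by rewrite c0.
Qed.

(** The differential of the product at (1, 1) is linear, and on each summand it
    is the identity because x 1 = x = 1 x. *)
Lemma dmap_mul11 (u v : V) :
  @dmap _ _ _ _ _ (prod_atlas A A) A (fun p : G * G => (p.1 * p.2)%g) (e, e) e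
    (1%g, 1%g) (u, v) = u + v.
Proof.
have m11 : cdom A e (1 * 1)%g by apply: e1'; rewrite mulg1.
have lin := @dmap_linear _ _ _ _ _ (prod_atlas A A) A _ (e, e) e (1%g, 1%g)
  (lie_mul LG) (conj e1 e1) m11.
set D := dmap _ _ _ _ in lin *.
have sid : smooth_map A A idfun := manifold_transition mA.
have D1 : D (u, 0) = u.
  have s1 := smooth_cst A A 1%g.
  have := @dmap_comp _ _ _ _ _ _ _ A (prod_atlas A A) A cA cAA
    (fun p : G * G => (p.1 * p.2)%g) (fun x => (x, 1%g)) e (e, e) e 1%g u
    (smooth_pair cA cA cA sid s1) (lie_mul LG) e1 (conj e1 e1) m11.
  rewrite (dmap_pair u sid s1 e1 e1 e1) dmap_cst (dmap_id cA u e1) -/D => <-.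
  rewrite (_ : _ \o _ = idfun) ?(dmap_id cA u e1)//.
  by apply/funext => x /=; rewrite mulg1.
have D2 : D (0, v) = v.
  have s1 := smooth_cst A A 1%g.
  have := @dmap_comp _ _ _ _ _ _ _ A (prod_atlas A A) A cA cAA
    (fun p : G * G => (p.1 * p.2)%g) (fun x => (1%g, x)) e (e, e) e 1%g v
    (smooth_pair cA cA cA s1 sid) (lie_mul LG) e1 (conj e1 e1) m11.
  rewrite (dmap_pair v s1 sid e1 e1 e1) dmap_cst (dmap_id cA v e1) -/D => <-.
  rewrite (_ : _ \o _ = idfun) ?(dmap_id cA v e1)//.
  by apply/funext => x /=; rewrite mul1g.
have := lin 1 (u, 0) (0, v); rewrite !scale1r D1 D2 => <-.
by congr D; apply: injective_projections; rewrite /= ?addr0 ?add0r.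
Qed.

Lemma velocity_mul (c1 c2 : R -> G) : smooth_curve A c1 -> smooth_curve A c2 ->
  c1 0 = 1%g -> c2 0 = 1%g ->
  velocity e (fun t => c1 t * c2 t)%g = velocity e c1 + velocity e c2.
Proof.
move=> s1 s2 c10 c20.
have m11 : cdom A e (c1 0 * c2 0)%g by apply: e1'; rewrite c10 c20 mulg1.
have := @dmap_comp _ _ _ _ _ _ _ T (prod_atlas A A) A cT cAA
  (fun p : G * G => (p.1 * p.2)%g) (fun t => (c1 t, c2 t)) tt (e, e) e 0 1
  (smooth_pair cT cA cA s1 s2) (lie_mul LG) I (conj (e1' c10) (e1' c20)) m11.
rewrite (@dmap_pair _ _ _ _ _ _ _ T A A _ _ tt e e)//; [|exact: e1'|exact: e1'].
by rewrite c10 c20 dmap_mul11.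
Qed.

Lemma smooth_curve_scale (a : R) (c : R -> G) : smooth_curve A c ->
  smooth_curve A (fun t => c (a * t)).
Proof.
move=> sc; apply: (smooth_comp (g := fun t : R^o => a * t) cT cT cA) sc.
  exact: smooth_basis_R.
split; first by move=> t; exact: mulrl_continuous.
move=> i j k; apply: (Ck_sub (B := setT)) => //.
pose f : {linear R^o -> R^o} := GRing.scale a.
apply: (@Ck_linear _ _ _ _ _ _ (fun x => x) f).
- exact: openT.
- by move=> t; exact: mulrl_continuous.
- exact: Ck_id.
Qed.

Lemma velocity_scale (a : R) (c : R -> G) : smooth_curve A c -> c 0 = 1%g ->
  velocity e (fun t => c (a * t)) = a *: velocity e c.
Proof.
move=> sc c0; rewrite /velocity.
pose f : {linear R^o -> R^o} := GRing.scale a.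
have fc : continuous f by move=> t; exact: mulrl_continuous.
have df : differentiable f 0 by exact: linear_differentiable.
have f0 : f 0 = 0 by rewrite linear0.
have dc : differentiable (chart A e \o c : R^o -> V) (f 0).
  rewrite f0.
  exact: (@smooth_differentiable _ _ _ _ _ T A c tt e 0 sc I (e1' c0)).
rewrite -[LHS]/('D_1 ((chart A e \o c) \o f) 0).
rewrite derive_comp// (deriveE _ df) diff_lin// f0.
move: dc; rewrite f0 => dc; rewrite !(deriveE _ dc).
by rewrite -linearZ/=; congr ('d _ _ _); rewrite /f/=.
Qed.

(** y |-> Ad y w is a partial derivative of (y, z) |-> y z y^-1 in the second
    variable, and this map is of class C^2. *)
Lemma differentiable_Ad (w : V) :
  differentiable (fun y => Ad e (cinv A e y) w) (chart A e 1%g).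
Proof.
pose L := @loc _ _ _ _ _ (prod_atlas A A) A
  (fun p : G * G => (p.1 * p.2 * p.1^-1)%g) (e, e) e.
pose z := chart A e 1%g.
have -> : (fun y => Ad e (cinv A e y) w) = 'D_((0 : V), w) L \o (fun y => (y, z)).
  apply/funext => y; rewrite /Ad /dmap /derive /=.
  apply: (congr1 (fun f : R -> V => lim (f h @[h --> 0^'])))%classic.
  apply/funext => h; congr (_ *: (_ - _)).
  rewrite (_ : h *: ((0 : V), w) + (y, z) = (y, h *: w + z))//.
  by apply: injective_projections => //=; rewrite scaler0 add0r.
apply: differentiable_comp.
  by apply: differentiable_pair; [exact: (@ex_diff _ _ _ _ _ _ _ (is_diff_id _))
    |exact: differentiable_cst].
have [_ /(_ (e, e) e 2%N)[_ /(_ (0, w))[h _]]] := smooth_conj_pair.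
apply: h; exists (1%g, 1%g) => //; split=> //.
by apply: e1'; rewrite /= mulg1 mulgV.
Qed.

(** The bracket is thus the derivative of Ad along any curve with the given
    velocity, in particular along a curve contained in a subgroup. *)
Lemma derive_Ad (c : R -> G) (w : V) : smooth_curve A c -> c 0 = 1%g ->
  differentiable (fun t : R^o => Ad e (c t) w) 0 /\
  'D_1 (fun t : R^o => Ad e (c t) w) 0 = bracket e (velocity e c) w.
Proof.
move=> sc c0.
have dc : differentiable (chart A e \o c : R^o -> V) 0.
  exact: (@smooth_differentiable _ _ _ _ _ T A c tt e 0 sc I (e1' c0)).
have dA := differentiable_Ad w.
have c0' : (chart A e \o c) 0 = chart A e 1%g by rewrite /= c0.
pose B y := Ad e (cinv A e y) w.
have near0 : \forall t \near (0 : R^o),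
    (B \o (chart A e \o c)) t = Ad e (c t) w.
  have : \forall t \near (0 : R^o), cdom A e (c t).
    by apply: (sc.1 0); apply: open_nbhs_nbhs; split;
      [exact: charted_open_cdom|exact: e1'].
  by apply: filterS => t ct; rewrite /B/= charted_chartK.
have dBc : differentiable (B \o (chart A e \o c)) (0 : R^o).
  by apply: differentiable_comp => //; rewrite c0'.
split; first exact: near_eq_diff near0 dBc.
by rewrite -(near_eq_derive (1 : R^o) near0) derive_comp ?c0'.
Qed.

Section SubgroupAlgebra.
Variable H : set G.
Hypotheses (H1 : H 1%g) (HM : forall x y, H x -> H y -> H (x * y)%g)
  (HV : forall x, H x -> H x^-1%g).

(** Combinations of velocities are velocities of products of reparametrised
    curves. *)
Lemma lie_algebra_of_lin a u v : lie_algebra_of e H u ->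
  lie_algebra_of e H v -> lie_algebra_of e H (a *: u + v).
Proof.
move=> [c [sc c0 cH <-]] [c' [sc' c0' cH' <-]].
have sac := smooth_curve_scale a sc.
exists (fun t => c (a * t)%R * c' t)%g; split.
- exact: smooth_curve_mul.
- by rewrite mulr0 c0 c0' mulg1.
- by move=> t; apply: HM.
- by rewrite velocity_mul ?mulr0// velocity_scale.
Qed.

Lemma lie_algebra_of0 : lie_algebra_of e H 0.
Proof.
exists (fun=> 1%g); split=> //; [exact: smooth_curve_cst|exact: velocity_cst].
Qed.

Lemma lie_algebra_of_Ad h u : H h -> lie_algebra_of e H u ->
  lie_algebra_of e H (Ad e h u).
Proof.
move=> Hh [c [sc c0 cH <-]]; exists (fun t => h * c t * h^-1)%g; split.
- exact: smooth_curve_conj.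
- by rewrite c0 mulg1 mulgV.
- by move=> t; apply: HM; [exact: HM|exact: HV].
- exact: velocity_conj.
Qed.

End SubgroupAlgebra.
End LieGroup.

(** For the bracket of u and v, take a curve c in the subgroup with velocity u.
    Then t |-> Ad (c t) v stays in the set of velocities of the subgroup, which is
    a linear subspace, and so does its derivative. *)
Lemma lie_subalgebra_of_subgroup (R : realType) (n : nat) (G : topGroupType)
    (A : atlas 'rV[R]_n G) (e : ix A) (H : set G) :
  lie_group e -> H 1%g -> (forall x y, H x -> H y -> H (x * y)%g) ->
  (forall x, H x -> H x^-1%g) -> lie_subalgebra e (lie_algebra_of e H).
Proof.
move=> LG H1 HM HV; have bV := @smooth_basis_rV R n.
have l0 := lie_algebra_of0 e H1.
have lin := lie_algebra_of_lin LG bV HM.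
split=> // u v [c [sc c0 cH <-]] vH.
have [dA <-] := derive_Ad LG bV v sc c0.
apply: derive_in_subspace => //.
by near=> t; exact: lie_algebra_of_Ad.
Unshelve. all: by end_near.
Qed.

(** * Integrals of continuous functions against a Borel probability *)

Section BorelIntegrals.
Context {R : realType} {M : ptopologicalType} (nu : probability (borel M) R).
Hypothesis Mc : compact [set: M].

Lemma ae_sub (P Q : M -> Prop) : (forall x, P x -> Q x) ->
  {ae nu, forall x, P x} -> {ae nu, forall x, Q x}.
Proof.
by apply: (@filterS (borel M) _ (ae_filter_ringOfSetsType nu)).
Qed.

Let nuT : nu [set: borel M] = 1%E. Proof. exact: probability_setT. Qed.

Definition mean (f : M -> R) : R := \int[nu]_(x in [set: borel M]) f x.

Lemma continuous_borel_measurable (f : M -> R) : continuous f ->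
  measurable_fun [set: borel M] (f : borel M -> R).
Proof.
move=> fc; apply: (measurability _ (RGenOpens.measurableE R)).
move=> _ [_ [a [b ->] <-]]; rewrite setTI; apply: sub_sigma_algebra.
by apply: open_comp => [x _|]; [exact: fc|exact: interval_open].
Qed.

Lemma continuous_self_measurable (f : M -> M) : continuous f ->
  measurable_fun [set: borel M] (f : borel M -> borel M).
Proof.
move=> fc.
apply: (@measurability _ _ (borel M) (borel M) _ _ (@open M : set (set (borel M)))) => //.
move=> _ [U Uo <-]; rewrite setTI; apply: sub_sigma_algebra.
by apply: open_comp => [x _|//]; exact: fc.
Qed.

Lemma continuous_bounded (f : M -> R) : continuous f ->
  exists2 C, 0 < C & forall x, `|f x| <= C.
Proof.
move=> fc; have [C0 [_ h]] : bounded_set (range f).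
  apply: (@compact_bounded R R^o); apply: continuous_compact => //.
  exact: continuous_subspaceT.
exists (Num.max 1 (C0 + 1)); first by rewrite lt_max ltr01.
by move=> x; apply: h; [rewrite lt_max ltrDl ltr01 orbT|exists x].
Qed.

Lemma continuous_integrable (f : M -> R) : continuous f ->
  nu.-integrable [set: borel M] (EFin \o (f : borel M -> R)).
Proof.
move=> fc; apply: measurable_bounded_integrable => //.
- by rewrite -[X in (X < _)%E]/(nu [set: borel M]) nuT ltry.
- exact: continuous_borel_measurable.
- have [C C0 fC] := continuous_bounded fc.
  exists C; split; first exact: num_real.
  by move=> N CN x _ /=; rewrite (le_trans (fC x))// ltW.
Qed.

Lemma continuous_measurable_EFin (f : M -> R) : continuous f ->
  measurable_fun [set: borel M] (EFin \o (f : borel M -> R)).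
Proof. by move=> fc; apply: (measurable_int nu); exact: continuous_integrable. Qed.

Lemma le_mean (f g : M -> R) : continuous f -> continuous g ->
  (forall x, f x <= g x) -> mean f <= mean g.
Proof.
by move=> fc gc fg; apply: le_Rintegral => //; exact: continuous_integrable.
Qed.

Lemma meanD (f g : M -> R) : continuous f -> continuous g ->
  mean (fun x => f x + g x) = mean f + mean g.
Proof. by move=> fc gc; apply: RintegralD => //; exact: continuous_integrable. Qed.

Lemma meanZ (a : R) (f : M -> R) : continuous f ->
  mean (fun x => a * f x) = a * mean f.
Proof. by move=> fc; apply: RintegralZl => //; exact: continuous_integrable. Qed.

Lemma mean_cst (a : R) : mean (fun=> a) = a.
Proof.
by rewrite /mean Rintegral_cst// -[X in fine X]/(nu [set: borel M]) nuT mulr1.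
Qed.

Lemma meanB (f g : M -> R) : continuous f -> continuous g ->
  mean (fun x => f x - g x) = mean f - mean g.
Proof. by move=> fc gc; apply: RintegralB => //; exact: continuous_integrable. Qed.

Lemma mean_sum (I : finType) (f : I -> M -> R) : (forall i, continuous (f i)) ->
  mean (fun x => \sum_i f i x) = \sum_i mean (f i).
Proof.
move=> fc.
suff : continuous (fun x => \sum_i f i x) /\
    mean (fun x => \sum_i f i x) = \sum_i mean (f i) by case.
elim: (index_enum I) => [|i s [sc IH]].
  split; last first.
    rewrite big_nil -[RHS]mean_cst; congr mean.
    by apply/funext => x; rewrite big_nil.
  rewrite (_ : (fun x => _) = cst 0); first by move=> x; exact: cst_continuous.
  by apply/funext => x; rewrite big_nil.
have E : (fun x => \sum_(j <- i :: s) f j x) =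
    (fun x => f i x + \sum_(j <- s) f j x).
  by apply/funext => x; rewrite big_cons.
rewrite E big_cons; split; last by rewrite meanD ?IH//; exact: fc.
by move=> x; apply: (@continuousD R R^o _ (f i)); [exact: fc|exact: sc].
Qed.

(** M being compact, [f (t, _)] tends to [f (t0, _)] uniformly as t tends to t0. *)
Lemma continuous_mean (T : topologicalType) (f : T * M -> R) : continuous f ->
  continuous (fun t => mean (fun x => f (t, x)) : R).
Proof.
move=> fc.
have fct t : continuous (fun x => f (t, x)).
  move=> x; apply: (@continuous_comp _ _ _ (fun x => (t, x)) f); last exact: fc.
  by apply: cvg_pair; [exact: cst_continuous|exact: cvg_id].
move=> t0; apply/cvgrPdist_le => e e0.
have : \forall t \near t0, [set: M] `<=` (fun x => `|f (t0, x) - f (t, x)| <= e).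
  have /compact_near_coveringP := Mc; apply => x _.
  have h1 : \forall p \near (t0, x), `|f (t0, x) - f p| <= e / 2.
    by have /cvgrPdist_le := fc (t0, x); apply; rewrite divr_gt0.
  have [[P Q] [/= Pt Qx] PQ] := h1.
  exists (Q, P) => //= -[x' t] /= [Qx' Pt'].
  have h2 := PQ (t, x') (conj Pt' Qx').
  have h3 := PQ (t0, x') (conj (nbhs_singleton Pt) Qx').
  rewrite (splitr e) -(subrK (f (t0, x)) (f (t0, x'))) -addrA.
  rewrite (le_trans (ler_normD _ _))// lerD// distrC//.
apply: filterS => t h; rewrite -meanB//.
rewrite ler_norml -[X in _ <= _ <= X]mean_cst -(mean_cst (- e)).
have cB : continuous (fun x => f (t0, x) - f (t, x)).
  by move=> x; apply: (@continuousB R R^o _ (fun x => f (t0, x))); exact: fct.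
have cst_c (a : R) : continuous (fun _ : M => a) by move=> x; exact: cst_continuous.
by apply/andP; split; apply: le_mean => // x; have := h x I;
  rewrite ler_norml => /andP[].
Qed.

Lemma mean_eq0 (f : M -> R) : continuous f -> (forall x, 0 <= f x) ->
  mean f = 0 -> {ae nu, forall x, f x = 0}.
Proof.
move=> fc f0 mf.
have fi := continuous_integrable fc.
have : (\int[nu]_(x in [set: borel M]) `|(EFin \o f) x| = 0)%E.
  transitivity (\int[nu]_(x in [set: borel M]) (f x)%:E)%E.
    by apply: eq_integral => x _ /=; rewrite ger0_norm.
  rewrite -[LHS]fineK; last exact: integrable_fin_num.
  by rewrite -[fine _]/(mean f) mf.
move/ae_eq_integral_abs => /(_ measurableT); case.
  exact: continuous_measurable_EFin.
by move=> N [mN N0 h]; exists N; split => // x hx; apply: h => /= H; apply: hx;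
  have [] := H I.
Qed.

Lemma eq_mean_ae (f g : M -> R) : continuous f -> continuous g ->
  {ae nu, forall x, f x = g x} -> mean f = mean g.
Proof.
move=> fc gc fg; rewrite /mean /Rintegral; congr fine.
apply: ae_eq_integral => //; try exact: continuous_measurable_EFin.
by apply: ae_sub fg => x -> _.
Qed.

Lemma mean_cvg_cst (f : nat -> M -> R) (C a : R) : (forall k, continuous (f k)) ->
  (forall k x, `|f k x| <= C) -> {ae nu, forall x, f k x @[k --> \oo] --> a} ->
  mean (f k) @[k --> \oo] --> a.
Proof.
move=> fc fC fa.
have [|||||_ _] := @dominated_convergence _ _ _ nu [set: borel M] measurableT
  (fun k => EFin \o f k) (EFin \o cst a) (EFin \o cst C).
- by move=> k; exact: continuous_measurable_EFin.
- exact/measurable_EFinP/measurable_cst.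
- by apply: ae_sub fa => x xa _; apply: cvg_EFin => //; exact: nearW.
- by apply: continuous_integrable => x; exact: cst_continuous.
- by apply: aeW => x k _; rewrite lee_fin.
have -> : (\int[nu]_(x in [set: borel M]) (EFin \o cst a) x = a%:E)%E.
  rewrite -[in RHS](mean_cst a) /mean /Rintegral fineK//.
  apply: integrable_fin_num => //; apply: continuous_integrable => x.
  exact: cst_continuous.
by move=> /fine_cvgP[_].
Qed.

End BorelIntegrals.

Section BorelPushforward.
Context {R : realType} {M : ptopologicalType} (nu : probability (borel M) R).

Lemma exists_pushforward (f : M -> M) : continuous f ->
  exists nu' : probability (borel M) R,
    (nu' : set (borel M) -> \bar R) = pushforward nu (f : borel M -> borel M).
Proof.
move=> fc; have mf := continuous_self_measurable fc.
pose X : {mfun borel M >-> borel M} :=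
  HB.pack (f : borel M -> borel M) (isMeasurableFun.Build _ _ _ _ _ mf).
by exists (distribution nu X).
Qed.

Hypothesis Mc : compact [set: M].

Lemma integral_push (f : M -> M) (phi : M -> R) : continuous f -> continuous phi ->
  (\int[pushforward nu (f : borel M -> borel M)]_(x in [set: borel M]) (phi x)%:E =
  \int[nu]_(x in [set: borel M]) (phi (f x))%:E)%E.
Proof.
move=> fc phic.
have phifc : continuous (phi \o f).
  by move=> x; apply: continuous_comp; [exact: fc|exact: phic].
apply: (integral_pushforward (continuous_self_measurable fc) (mu := nu)
  (D := [set: borel M]) (f := EFin \o phi)) => //.
- exact: (continuous_measurable_EFin nu Mc phic).
- exact: (continuous_integrable nu Mc phifc).
Qed.

Lemma mean_comp_eq (f h : M -> M) (phi : M -> R) :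
  continuous f -> continuous h -> continuous phi ->
  (forall B : set (borel M), measurable B ->
    pushforward nu (f : borel M -> borel M) B =
    pushforward nu (h : borel M -> borel M) B) ->
  mean nu (phi \o f) = mean nu (phi \o h).
Proof.
move=> fc hc phic fh; rewrite /mean /Rintegral; congr fine.
rewrite -(integral_push fc phic) -(integral_push hc phic).
have [nuf nufE] := exists_pushforward fc; have [nuh nuhE] := exists_pushforward hc.
rewrite -nufE -nuhE; apply: eq_measure_integral => B mB _.
have := fh B mB; rewrite -nufE -nuhE; exact.
Qed.

End BorelPushforward.

(** * The gradient flow of a component of the momentum map *)

Lemma derive_shift0 (R : realType) (W : normedModType R) (f : R^o -> W) (s : R) :
  differentiable (fun t : R^o => f (s + t)) 0 ->
  differentiable f s /\ 'D_1 f s = 'D_1 (fun t : R^o => f (s + t)) 0.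
Proof.
move=> df.
have fE : f = (fun t : R^o => f (s + t)) \o (fun t : R^o => t - s).
  by apply/funext => t /=; rewrite addrC subrK.
have dsub (t : R^o) : differentiable (fun t : R^o => t - s) t.
  apply: (@differentiableB _ _ _ (fun x : R^o => x) (cst s)).
    exact: (@ex_diff _ _ _ _ _ _ _ (is_diff_id _)).
  exact: differentiable_cst.
split.
  rewrite fE; apply: differentiable_comp; first exact: dsub.
  by rewrite subrr.
rewrite {1}fE derive_comp ?subrr//.
congr (derive _ _ _); rewrite deriveB.
- by rewrite derive_id derive_cst subr0.
- exact: derivable_id.
- exact: derivable_cst.
Qed.

Lemma nondecreasing_of_derive (R : realType) (f : R^o -> R^o) :
  (forall t, differentiable f t) -> (forall t, 0 <= 'D_1 f t) ->
  forall s t, s <= t -> f s <= f t.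
Proof.
move=> df f'0 s t st.
apply: (@ger0_derive1_ndecr R f s t) => //.
- by move=> x _; exact: diff_derivable.
- by move=> x _; rewrite derive1E.
- apply: continuous_subspaceT => x; exact: differentiable_continuous.
Qed.

Lemma constant_of_derive (R : realType) (f : R^o -> R^o) :
  (forall t, differentiable f t) -> (forall t, 'D_1 f t = 0) ->
  forall s t, f s = f t.
Proof.
move=> df f'0 s t; apply: (@is_derive_0_is_cst R f) => x.
by rewrite -(f'0 x); apply: derivableP; exact: diff_derivable.
Qed.

Section KaehlerAction.
Context (R : realType) (n d : nat)
  (M : ptopologicalType) (AM : atlas (Cn R d) M) (g : tensor2 AM)
  (K : topGroupType) (AK : atlas 'rV[R]_n K) (eK : ix AK)
  (G : topGroupType) (AG : atlas (Cn R n) G) (eG : ix AG)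
  (iota : K -> G) (ex : Cn R n -> G)
  (aK : K -> M -> M) (aG : G -> M -> M) (mu : M -> 'rV[R]_n).
Hypotheses (M_compact : compact [set: M]) (M_kaehler : kaehler g)
  (K_compact : compact [set: K]) (K_lie : lie_group eK)
  (mu_momentum : momentum_map g eK aK mu)
  (G_complexification : complexification eK eG iota ex)
  (G_action : holomorphic_extension g eK eG iota aK aG mu).

Local Notation TR := (triv_atlas (R^o : normedModType R)).
Local Notation imulK := (imul eK eG iota).
Local Notation flow := (iflow eK eG iota ex aG).
Implicit Types (v w : 'rV[R]_n) (x : M).

Let G_lie : lie_group eG.
Proof. by case: (cplx_lie G_complexification). Qed.
Let cG : charted AG := manifold_charted (lie_manifold G_lie).
Let cK : charted AK := manifold_charted (lie_manifold K_lie).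
Let mM : manifold AM.
Proof. by case: (kaehler_complex M_kaehler). Qed.
Let cM : charted AM := manifold_charted mM.
Let cR : charted TR := charted_triv _.
Let bCn k : smooth_basis (Cn R k) :=
  smooth_basis_prod (@smooth_basis_rV R k) (@smooth_basis_rV R k).
Let exP := cplx_exp G_complexification.

Lemma iota1 : iota 1%g = 1%g.
Proof.
apply: (mulgI (iota 1%g)).
by rewrite -(cplx_morph G_complexification) !mulg1.
Qed.

Lemma iotaV k : iota k^-1%g = (iota k)^-1%g.
Proof.
apply: (mulgI (iota k)).
by rewrite -(cplx_morph G_complexification) !mulgV iota1.
Qed.

Lemma diota_linear : linear (diota eK eG iota).
Proof.
apply: dmap_linear; first exact: cplx_smooth G_complexification.
  exact: lie_chart1 K_lie.
by rewrite iota1; exact: lie_chart1 G_lie.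
Qed.

Lemma imulZ a v : imulK (a *: v) = a *: imulK v.
Proof.
have d0 : diota eK eG iota 0 = 0.
  by have := diota_linear (-1) 0 0; rewrite scaler0 addr0 scaleN1r addNr.
rewrite /imul; have := diota_linear a v 0; rewrite d0 !addr0 => ->.
by apply: injective_projections => //=; rewrite scalerN.
Qed.

Lemma exD xi s t : ex ((s + t) *: xi) = (ex (s *: xi) * ex (t *: xi))%g.
Proof. by have [] := exP xi. Qed.

Lemma ex0 : ex 0 = 1%g.
Proof.
have := exD 0 0 0; rewrite addr0 !scale0r => E.
by apply: (mulgI (ex 0)); rewrite -E mulg1.
Qed.

Lemma aG1 x : aG 1%g x = x.
Proof. by have [] := hx_action G_action. Qed.

Lemma aGM h k x : aG (h * k)%g x = aG h (aG k x).
Proof. by have [] := hx_action G_action. Qed.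

Lemma smooth_aG : smooth_map (prod_atlas AG AM) AM (fun p : G * M => aG p.1 p.2).
Proof. by have [] := hx_action G_action. Qed.

Lemma smooth_aG_at h : smooth_map AM AM (aG h).
Proof.
have s1 : smooth_map AM (prod_atlas AG AM) (fun x => (h, x)).
  by apply: smooth_pair => //; [exact: smooth_cst|exact: manifold_transition].
exact: (smooth_comp cM (charted_prod cG cM) cM (smooth_basis_prod (bCn n) (bCn d))
  s1 smooth_aG).
Qed.

Lemma continuous_aG h : continuous (aG h).
Proof. exact: (smooth_aG_at h).1. Qed.

Lemma smooth_orbit x : smooth_map AG AM (aG^~ x).
Proof.
have s1 : smooth_map AG (prod_atlas AG AM) (fun h => (h, x)).
  apply: smooth_pair => //; last exact: smooth_cst.
  exact: manifold_transition (lie_manifold G_lie).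
exact: (smooth_comp cG (charted_prod cG cM) cM (smooth_basis_prod (bCn n) (bCn d))
  s1 smooth_aG).
Qed.

(** The joint continuity of the exponential on i Lie(K) comes from the polar
    decomposition, whose restriction to 1 in K it is. *)
Lemma continuous_ex_imul : continuous (fun v => ex (imulK v)).
Proof.
have [[pc _] _] := cplx_polar G_complexification.
rewrite (_ : (fun v => _) = (fun p : K * 'rV[R]_n => (iota p.1 * ex (imulK p.2))%g)
   \o (fun v => (1%g, v))).
  move=> v; apply: continuous_comp; last exact: pc.
  exact: continuous_pairl.
by apply/funext => v /=; rewrite iota1 mul1g.
Qed.

Lemma flow0 v x : flow v x 0 = x.
Proof. by rewrite /iflow scale0r ex0 aG1. Qed.

Lemma flowD v x s t : flow v x (s + t) = flow v (flow v x s) t.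
Proof. by rewrite /iflow addrC exD aGM. Qed.

Lemma flow_ex v x t : flow v x t = aG (ex (imulK (t *: v))) x.
Proof. by rewrite /iflow imulZ. Qed.

(** The chain rule for t |-> exp(itv) |-> exp(itv) x |-> F. *)
Lemma derive_flow0 (F : M -> R^o) v x i : smooth_map AM TR F -> cdom AM i x ->
  differentiable (fun t : R^o => F (flow v x t)) 0 /\
  'D_1 (fun t : R^o => F (flow v x t)) 0 =
  @dmap _ _ _ _ _ AM TR F i tt x (fundamental eG aG (imulK v) i x).
Proof.
move=> sF ix; have [sc _ velc] := exP (imulK v).
set c := fun t => ex (t *: imulK v) in sc velc.
have c0 : c 0 = 1%g by rewrite /c scale0r ex0.
have sFo : smooth_map AG TR (F \o aG^~ x).
  exact: (smooth_comp cG cM cR (bCn d) (smooth_orbit x) sF).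
have e1 : cdom AG eG 1%g := lie_chart1 G_lie.
have sFoc : smooth_map TR TR ((F \o aG^~ x) \o c).
  exact: (smooth_comp cR cG cR (bCn n) sc sFo).
split; first exact: (@smooth_differentiable _ _ _ _ _ TR TR _ tt tt 0 sFoc I I).
have ec0 : cdom AG eG (c 0) by rewrite c0.
have := @dmap_comp _ _ _ _ _ _ _ TR AG TR cR cG (F \o aG^~ x) c tt eG tt 0 1 sc sFo
  I ec0 I.
have vE : @dmap _ _ _ _ _ TR AG c tt eG 0 1 = imulK v := velc.
rewrite vE c0 => E; rewrite -[LHS]/(@dmap _ _ _ _ _ TR TR ((F \o aG^~ x) \o c) tt tt 0 1).
rewrite E; have ix1 : cdom AM i (aG 1%g x) by rewrite aG1.
have := @dmap_comp _ _ _ _ _ _ _ AG AM TR cG cM F (aG^~ x) eG i tt 1%g (imulK v)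
  (smooth_orbit x) sF e1 ix1 I.
by move=> ->; rewrite aG1.
Qed.

Lemma derive_flow (F : M -> R^o) v x s i : smooth_map AM TR F ->
  cdom AM i (flow v x s) ->
  differentiable (fun t : R^o => F (flow v x t)) s /\
  'D_1 (fun t : R^o => F (flow v x t)) s =
  @dmap _ _ _ _ _ AM TR F i tt (flow v x s)
    (fundamental eG aG (imulK v) i (flow v x s)).
Proof.
move=> sF ix; have [dF DF] := derive_flow0 v sF ix.
have E : (fun t : R^o => F (flow v (flow v x s) t)) =
    (fun t : R^o => F (flow v x (s + t))).
  by apply/funext => t; rewrite flowD.
rewrite E in dF DF.
have [dFs DFs] := @derive_shift0 _ _ (fun t : R^o => F (flow v x t)) s dF.
by split; [exact: dFs|exact: etrans DFs DF].
Qed.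

(** If the field of iv vanishes at [x], then the derivative of F at time s is the
    image of 0 under the differential of F o exp(isv) at [x].  This replaces the
    uniqueness of integral curves. *)
Lemma derive_flow_stationary (F : M -> R^o) v x i : smooth_map AM TR F ->
  cdom AM i x -> fundamental eG aG (imulK v) i x = 0 ->
  forall t, F (flow v x t) = F x.
Proof.
move=> sF ix f0 t; rewrite -[in RHS](flow0 v x).
apply: (constant_of_derive (f := fun t : R^o => F (flow v x t))) => [s|s].
  have [j jx] := charted_cover cM (flow v x s).
  by have [] := derive_flow sF jx.
pose F' : M -> R^o := F \o aG (ex (s *: imulK v)).
have sF' : smooth_map AM TR F'.
  exact: (smooth_comp cM cM cR (bCn d) (smooth_aG_at _) sF).
have E : (fun t : R^o => F' (flow v x t)) = (fun t : R^o => F (flow v x (s + t))).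
  by apply/funext => r; rewrite /F'/= /iflow exD aGM.
have [dF DF] := derive_flow0 v sF' ix; rewrite E in dF DF.
have [_ ->] := @derive_shift0 _ _ (fun t : R^o => F (flow v x t)) s dF.
rewrite DF f0 /dmap deriveE ?linear0//.
exact: (@smooth_differentiable _ _ _ _ _ AM TR F' i tt x sF' ix I).
Qed.

Let pair_lin v : linear (fun u : 'rV[R]_n => pairing u v : R^o).
Proof. by move=> a u w; rewrite /pairing mulmxDl -scalemxAl !mxE. Qed.

Lemma pairing_continuous v : continuous (fun u : 'rV[R]_n => pairing u v : R).
Proof.
pose l : {linear 'rV[R]_n -> R^o} := HB.pack (fun u : 'rV[R]_n => pairing u v : R^o)
  (GRing.isLinear.Build _ _ _ _ _ (pair_lin v)).
exact: (@linear_rV_continuous _ _ _ l).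
Qed.

Lemma smooth_mu_comp v : smooth_map AM TR (mu_comp mu v).
Proof.
have sp : smooth_map (triv_atlas ('rV[R]_n : normedModType R)) TR
    (fun u : 'rV[R]_n => pairing u v : R^o).
  split; first exact: pairing_continuous.
  move=> i j k; apply: (Ck_sub (B := setT)) => //.
  pose l : {linear 'rV[R]_n -> R^o} := HB.pack (fun u : 'rV[R]_n => pairing u v : R^o)
    (GRing.isLinear.Build _ _ _ _ _ (pair_lin v)).
  exact: (@linear_rV_smooth _ _ _ _ l).
exact: (smooth_comp cM (charted_triv _) cR (@smooth_basis_rV R n)
  (mm_smooth mu_momentum) sp).
Qed.

Lemma mu_comp_delta x j : mu_comp mu (delta_mx 0 j) x = mu x 0 j.
Proof. exact: pairing_delta. Qed.

Lemma derive_mu_flow v x s i : cdom AM i (flow v x s) ->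
  differentiable (fun t : R^o => mu_comp mu v (flow v x t)) s /\
  'D_1 (fun t : R^o => mu_comp mu v (flow v x t)) s =
  g i (flow v x s) (fundamental eG aG (imulK v) i (flow v x s))
    (fundamental eG aG (imulK v) i (flow v x s)).
Proof.
move=> ix; have [dF ->] := derive_flow (smooth_mu_comp v) ix.
by split=> //; rewrite (hx_grad G_action).
Qed.

Let g_sp i x : cdom AM i x -> scalar_product (g i x).
Proof. by move=> ix; exact: riemannian_sp (kaehler_riemannian M_kaehler) _ _ ix. Qed.

(** (iv)_M is the gradient of mu^v, so the derivative is a squared norm. *)
Lemma mu_flow_nondecreasing v x s t : s <= t ->
  mu_comp mu v (flow v x s) <= mu_comp mu v (flow v x t).
Proof.
apply: (nondecreasing_of_derive (f := fun t : R^o => mu_comp mu v (flow v x t))) => r;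
  have [i ix] := charted_cover cM (flow v x r); have [dF DF] := derive_mu_flow ix => //.
rewrite DF; set u := fundamental _ _ _ _ _; have [gl _ gp] := g_sp ix.
have [->|u0] := eqVneq u 0; last exact/ltW/gp.
have := gl (-1) 0 0 0; rewrite scaler0 addr0 mulN1r => ->.
by rewrite addNr.
Qed.

(** By monotonicity mu^v is constant on [0, 1], so its gradient vanishes at time
    1 / 2, an interior time, where a two-sided derivative can be read off. *)
Lemma mu_flow_stationary v x : mu_comp mu v (flow v x 1) = mu_comp mu v x ->
  forall t, mu (flow v x t) = mu x.
Proof.
move=> x1.
have cst01 t : 0 <= t -> t <= 1 -> mu_comp mu v (flow v x t) = mu_comp mu v x.
  move=> t0 t1; apply/eqP; rewrite eq_le -{1}x1 mu_flow_nondecreasing//=.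
  by rewrite -{1}(flow0 v x) mu_flow_nondecreasing.
pose y := flow v x (1 / 2); have [i iy] := charted_cover cM y.
have fund0 : fundamental eG aG (imulK v) i y = 0.
  have [_ DF] := derive_mu_flow iy; have [_ _ gp] := g_sp iy.
  apply/eqP/negP => /negP /gp; rewrite -DF.
  rewrite (near_eq_derive (g := cst (mu_comp mu v x)) (1 : R^o)) ?derive_cst ?ltxx//.
  have /near_in_itvoo : (1 / 2 : R) \in `]0, 1[ by rewrite in_itv /=; lra.
  by apply: filterS => t; rewrite in_itv /= => /andP[t0 t1]; rewrite cst01// ltW.
have const t : mu (flow v y t) = mu y.
  apply/rowP => j; rewrite -!mu_comp_delta.
  exact: (derive_flow_stationary (smooth_mu_comp _) iy fund0).
move=> t; rewrite -(subrK (1 / 2) t) addrC flowD const -(const (- (1 / 2))).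
by rewrite -flowD subrr flow0.
Unshelve. all: by end_near. Qed.

(** * The momentum of a translated measure *)

Lemma continuous_mu : continuous mu.
Proof. by case: (mm_smooth mu_momentum). Qed.

Lemma continuous_mu_comp v : continuous (mu_comp mu v : M -> R).
Proof. by case: (smooth_mu_comp v). Qed.

Lemma continuous_mu_coord j : continuous (fun x => mu x 0 j : R).
Proof.
move=> x; apply: (@continuous_comp _ _ _ mu (fun u : 'rV[R]_n => u 0 j)).
  exact: continuous_mu.
exact: coord_continuous.
Qed.

Lemma continuous_mu_aG v h : continuous (fun x => mu_comp mu v (aG h x) : R).
Proof.
move=> x; apply: (@continuous_comp _ _ _ (aG h) (mu_comp mu v : M -> R)).
  exact: continuous_aG.
exact: continuous_mu_comp.
Qed.

Lemma continuous_mu_flow v t : continuous (fun x => mu_comp mu v (flow v x t) : R).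
Proof. exact: continuous_mu_aG. Qed.

Lemma flow_scale a v x t : flow (a *: v) x t = flow v x (a * t).
Proof. by rewrite !flow_ex scalerA mulrC. Qed.

Lemma mu_comp_scale a v x : mu_comp mu (a *: v) x = a * mu_comp mu v x.
Proof. exact: pairingZr. Qed.

Lemma has_sup_mu_comp v : has_sup (range (mu_comp mu v : M -> R)).
Proof.
split; first by exists (mu_comp mu v point), point.
have [C C0 h] := continuous_bounded M_compact (@continuous_mu_comp v).
by exists C => _ [x _ <-]; have := h x; rewrite ler_norml => /andP[].
Qed.

(** The half-space mu^v <= sup mu^v is convex and contains the image of mu, hence
    a small positive multiple of v. *)
Lemma sup_mu_comp_gt0 v : Omega mu 0 -> v != 0 ->
  0 < sup (range (mu_comp mu v : M -> R)).
Proof.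
move=> /nbhs_ballP[e /= e0 hull] v0.
have nv0 : 0 < `|v| by rewrite normr_gt0.
pose b := e / 2 / `|v|; have b0 : 0 < b by rewrite !divr_gt0.
have /hull : ball (0 : 'rV[R]_n) e (b *: v).
  rewrite -ball_normE /ball_/= sub0r normrN normrZ gtr0_norm// divfK ?gt_eqF//.
  by rewrite ltr_pdivrMr// mulr_natr mulr2n ltrDr.
move=> /(_ [set u | pairing u v <= sup (range (mu_comp mu v : M -> R))]).
rewrite /= pairingZl => h; apply: lt_le_trans (h _ _).
- by rewrite mulr_gt0// pairing_gt0.
- move=> x y l; rewrite !inE /= => hx hy.
  have -> : pairing (conv l x y) v =
      l%:num * pairing x v + (1 - l%:num) * pairing y v.
    rewrite -!pairingZl -[conv l x y]/(l%:num *: x + (1 - l%:num) *: y).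
    by rewrite /pairing mulmxDl mxE.
  set s := sup _ in hx hy *.
  have l0 : 0 <= l%:num by [].
  have l1 : l%:num <= 1 by [].
  have l1' : 0 <= 1 - l%:num by rewrite subr_ge0.
  have := ler_wpM2l l0 hx; have := ler_wpM2l l1' hy; lra.
- move=> _ [x _ <-]; apply: (sup_upper_bound (has_sup_mu_comp v)).
  by exists x.
Qed.

Hypothesis flow_limits : forall x v,
  exists y : M, flow v x t @[t --> +oo] --> y.

(** By monotonicity the limit of mu^v along the flow line is its supremum over
    integer times; this description makes the set Borel. *)
Lemma max_unstableE v : max_unstable eK eG iota ex aG mu v =
  \bigcap_(k in [set: nat]) \bigcup_(m in [set: nat])
    [set x | sup (range (mu_comp mu v : M -> R)) - k.+1%:R^-1
       < mu_comp mu v (flow v x m%:R)].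
Proof.
set s := sup _.
have lim x y : flow v x t @[t --> +oo] --> y ->
    mu_comp mu v (flow v x m%:R) @[m --> \oo] --> mu_comp mu v y.
  move=> xy; have h : flow v x m%:R @[m --> \oo] --> y.
    by apply: (cvg_comp _ _ _ xy); exact: cvgr_idn.
  apply: (@cvg_comp _ _ _ (fun m : nat => flow v x m%:R) (mu_comp mu v : M -> R) _ _ _ h).
  exact: continuous_mu_comp.
apply/seteqP; split=> x.
  move=> [y xy yE] k _; have h := lim x y xy; rewrite yE in h.
  have /cvgrPdist_lt/(_ k.+1%:R^-1) := h; rewrite invr_gt0 ltr0n => /(_ isT)[N _ hN].
  exists N => //=; have := hN N (leqnn N); rewrite ltr_norml => /andP[_] sN.
  by rewrite /= ltrBlDl addrC -ltrBlDl.
move=> h; have [y xy] := flow_limits x v; exists y => //.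
apply/eqP; rewrite eq_le; apply/andP; split.
  by apply: (sup_upper_bound (has_sup_mu_comp v)); exists y.
apply/ler_addgt0Pl => e e0.
have [k ke] : exists k : nat, k.+1%:R^-1 < e.
  have [k _ kP] := @near_infty_natSinv_lt R (PosNum e0).
  by exists k; exact: (kP k (leqnn k)).
have [m _ /= hm] := h k I.
have le_lim : mu_comp mu v (flow v x m%:R) <= mu_comp mu v y.
  rewrite -(cvg_lim (@Rhausdorff R) (lim x y xy)).
  apply: limr_ge; first by apply: cvgP; exact: lim xy.
  near=> p; apply: mu_flow_nondecreasing; rewrite ler_nat; near: p.
  exact: nbhs_infty_ge.
apply: ltW; rewrite -ltrBlDl.
apply: (lt_le_trans _ le_lim); apply: lt_trans hm.
by rewrite ltrD2l ltrN2.
Unshelve. all: by end_near. Qed.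

Lemma measurable_max_unstable v :
  measurable (max_unstable eK eG iota ex aG mu v : set (borel M)).
Proof.
rewrite max_unstableE; apply: bigcap_measurable => [|k _]; first by exists 0%N.
apply: bigcup_measurable => m _; apply: sub_sigma_algebra.
apply: (@open_comp _ _ (fun x => mu_comp mu v (flow v x m%:R) : R)
  [set r | _ < r]); last exact: open_gt.
by move=> x _; exact: continuous_mu_flow.
Qed.

Context (q : 'rV[R]_n -> 'rV[R]_n -> R) (nu : probability (borel M) R).
Hypotheses (q_sp : scalar_product q)
  (nu_W : measures_W eK eG iota ex aG mu q nu) (zero_Omega : Omega mu 0).

(** Dominated convergence: for almost every point the integrand tends to the
    maximum of mu^v. *)
Lemma mean_mu_flow_cvg v : q v v = 1 ->
  mean nu (fun x => mu_comp mu v (flow v x k%:R)) @[k --> \oo] -->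
  sup (range (mu_comp mu v : M -> R)).
Proof.
move=> qv1.
have [C C0 hC] := continuous_bounded M_compact (@continuous_mu_comp v).
apply: (@mean_cvg_cst _ _ nu M_compact
   (fun k x => mu_comp mu v (flow v x k%:R)) C) => [k||].
- exact: continuous_mu_flow.
- by move=> k x; exact: hC.
exists (~` max_unstable eK eG iota ex aG mu v); split.
- exact: (measurableC (measurable_max_unstable v)).
- have := probability_setC nu (measurable_max_unstable v).
  rewrite nu_W// => E.
  apply: etrans E _; by rewrite subee.
- move=> x /= + [y xy yE]; apply; rewrite -yE.
  have h : flow v x m%:R @[m --> \oo] --> y.
    by apply: (cvg_comp _ _ _ xy); exact: cvgr_idn.
  apply: (@cvg_comp _ _ _ (fun m : nat => flow v x m%:R) (mu_comp mu v : M -> R) _ _ _ h).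
  exact: continuous_mu_comp.
Qed.

(** The membership of nu in W concerns unit vectors for [q]; a general direction
    is rescaled, which changes the speed of the flow by the same factor. *)
Lemma exists_mean_mu_flow_gt0 w : w != 0 ->
  exists2 t, 0 <= t & 0 < mean nu (fun x => mu_comp mu w (flow w x t)).
Proof.
move=> w0; have qw : 0 < q w w by case: q_sp => _ _; apply.
pose c := Num.sqrt (q w w); have c0 : 0 < c by rewrite sqrtr_gt0.
pose v := c^-1 *: w.
have qZl a u u' : q (a *: u) u' = a * q u u'.
  have [ql _ _] := q_sp.
  have q0 : q 0 u' = 0.
    by have := ql (-1) 0 0 u'; rewrite scaler0 addr0 mulN1r addNr.
  by have := ql a u 0 u'; rewrite addr0 q0 addr0.
have qv1 : q v v = 1.
  have [_ qs _] := q_sp.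
  rewrite /v qZl qs qZl mulrA -expr2 exprVn sqr_sqrtr ?ltW// mulVf// gt_eqF//.
have v0 : v != 0 by rewrite scaler_eq0 negb_or invr_eq0 gt_eqF.
have s0 := sup_mu_comp_gt0 zero_Omega v0.
have [N _ hN] := cvgr_gt _ (mean_mu_flow_cvg qv1) _ s0.
exists (c^-1 * N%:R); first by rewrite mulr_ge0// invr_ge0 ltW.
have E : mean nu (fun x => mu_comp mu v (flow v x N%:R)) =
    c^-1 * mean nu (fun x => mu_comp mu w (flow w x (c^-1 * N%:R))).
  rewrite -(meanZ nu M_compact); last exact: continuous_mu_flow.
  by congr (mean nu _); apply/funext => x; rewrite mu_comp_scale flow_scale.
have h : 0 < mean nu (fun x => mu_comp mu v (flow v x N%:R)) := hN N (leqnn N).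
have c'0 : 0 < c^-1 by rewrite invr_gt0.
by have := eq_ind _ (fun z => 0 < z) h _ E; rewrite (pmulr_rgt0 _ c'0).
Qed.

Lemma continuous_mu_ex (F : M -> R) (t : R) : continuous F ->
  continuous (fun p : 'rV[R]_n * M => F (aG (ex (imulK (t *: p.1))) p.2)).
Proof.
move=> Fc p.
apply: (@continuous_comp _ _ _
    (fun p : 'rV[R]_n * M => aG (ex (imulK (t *: p.1))) p.2) F);
  last exact: Fc.
apply: (@continuous_comp _ _ _ (fun p : 'rV[R]_n * M => (ex (imulK (t *: p.1)), p.2))
  (fun p : G * M => aG p.1 p.2)); last exact: smooth_aG.1.
move: p; apply: continuous_pair => p; last exact: cvg_snd.
apply: (@continuous_comp _ _ _ fst (fun v : 'rV[R]_n => ex (imulK (t *: v)))).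
  exact: cvg_fst.
apply: (@continuous_comp _ _ _ (fun v : 'rV[R]_n => t *: v) (fun v => ex (imulK v))).
  by apply: (@continuousZ _ _ _ (cst t) id); [exact: cst_continuous|exact: cvg_id].
exact: continuous_ex_imul.
Qed.

Lemma mean_mu_compE h v :
  mean nu (fun x => mu_comp mu v (aG h x)) =
  pairing (\row_j mean nu (fun x => mu (aG h x) 0 j)) v.
Proof.
rewrite pairingE; under eq_bigr => j _ do rewrite mxE mulrC.
have hc j : continuous (fun x => mu (aG h x) 0 j : R).
  move=> x; apply: (@continuous_comp _ _ _ (aG h) (fun x => mu x 0 j : R)).
    exact: continuous_aG.
  exact: continuous_mu_coord.
under eq_bigr => j _ do rewrite -meanZ//.
rewrite -mean_sum//; last first.
  move=> j x; apply: (@continuousM _ _ (cst (v 0 j))); last exact: hc.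
  exact: cst_continuous.
congr mean; apply/funext => x; rewrite /mu_comp pairingE.
by apply: eq_bigr => j _; rewrite mulrC.
Qed.

Lemma momentum_push h :
  momentum mu (push aG h nu) = \row_j mean nu (fun x => mu (aG h x) 0 j).
Proof.
apply/rowP => j; rewrite !mxE /push (integral_push nu M_compact)//.
- exact: continuous_aG.
- exact: continuous_mu_coord.
Qed.

Lemma pairing_momentum h v : pairing (momentum mu (push aG h nu)) v =
  mean nu (fun x => mu_comp mu v (aG h x)).
Proof. by rewrite momentum_push mean_mu_compE. Qed.

(** * Zeros of the momentum *)

Local Notation Fmom h := (momentum mu (push aG h nu)).

Lemma mean_mu_flow_nondecreasing w s t : s <= t ->
  mean nu (fun x => mu_comp mu w (flow w x s)) <=
  mean nu (fun x => mu_comp mu w (flow w x t)).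
Proof.
move=> st; apply: (le_mean nu M_compact); try exact: continuous_mu_flow.
by move=> x; exact: mu_flow_nondecreasing.
Qed.

Lemma continuous_momentum_ex (t : R) :
  continuous (fun w => Fmom (ex (imulK (t *: w)))).
Proof.
apply: rV_continuousP => j.
rewrite (_ : (fun w => _) =
    (fun w => mean nu (fun x => mu (aG (ex (imulK (t *: w))) x) 0 j))).
  apply: (@continuous_mean _ _ nu M_compact _
    (fun p : 'rV[R]_n * M => mu (aG (ex (imulK (t *: p.1))) p.2) 0 j)).
  exact: (@continuous_mu_ex (fun x => mu x 0 j) t (continuous_mu_coord (j:=j))).
by apply/funext => w; rewrite momentum_push mxE.
Qed.

Lemma pairing_momentum_flow w t : pairing (Fmom (ex (imulK (t *: w)))) w =
  mean nu (fun x => mu_comp mu w (flow w x t)).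
Proof.
rewrite pairing_momentum; congr (mean nu _); apply/funext => x.
by rewrite flow_ex.
Qed.

(** Once positive in a direction, <Phi(tw), w> remains so for larger t and for
    nearby w; compactness of the unit sphere makes the threshold uniform. *)
Lemma momentum_outward : exists2 T, 0 < T &
  forall v, T <= `|v| -> 0 < pairing (Fmom (ex (imulK v))) v.
Proof.
pose S := [set w : 'rV[R]_n | `|w| = 1].
have Sc : compact S.
  apply: bounded_closed_compact.
    exists 1; split; first exact: num_real.
    by move=> C C1 w /= ->; exact: ltW.
  apply: (@closed_comp _ _ (fun v : 'rV[R]_n => `|v|) [set x : R | x = 1]).
    by move=> v _; exact: norm_continuous.
  exact: closed_eq.
pose P (T : R) (w : 'rV[R]_n) := forall t, T <= t ->
  0 < pairing (Fmom (ex (imulK (t *: w)))) w.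
have : \forall T \near +oo, S `<=` P T.
  have /compact_near_coveringP := Sc; apply => w Sw.
  have w0 : w != 0 by rewrite -normr_eq0 Sw oner_eq0.
  have [t0 t00] := exists_mean_mu_flow_gt0 w0.
  rewrite -pairing_momentum_flow => Fw.
  have cF : continuous (fun w => pairing (Fmom (ex (imulK (t0 *: w)))) w : R).
    apply: (@continuous_pairing R n _ (fun w => Fmom (ex (imulK (t0 *: w)))) id).
      exact: continuous_momentum_ex.
    by move=> z; exact: cvg_id.
  have nw : \forall w' \near w, 0 < pairing (Fmom (ex (imulK (t0 *: w')))) w'.
    exact: (cvgr_gt _ (cF w)).
  exists ([set w' | 0 < pairing (Fmom (ex (imulK (t0 *: w')))) w'],
      [set T | t0 <= T]) => /=.
    by split=> //; apply: nbhs_pinfty_ge; exact: num_real.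
  move=> [w' T] /= [Fw' t0T] t Tt; apply: lt_le_trans Fw' _.
  have le_t0t := mean_mu_flow_nondecreasing w' (le_trans t0T Tt).
  exact: (eq_ind_r (fun z => z <= _)
    (eq_ind_r (fun z => _ <= z) le_t0t (pairing_momentum_flow w' t))
    (pairing_momentum_flow w' t0)).
move=> [T0 [_ hT0]]; pose T := Num.max 1 (T0 + 1).
have T1 : 1 <= T by rewrite le_max lexx.
have T00 : T0 < T by rewrite lt_max ltrDl ltr01 orbT.
exists T; first exact: lt_le_trans T1.
move=> v Tv; have v0 : 0 < `|v| by apply: lt_le_trans Tv; exact: lt_le_trans T1.
have Sv : S (`|v|^-1 *: v).
  by rewrite /S/= normrZ gtr0_norm ?invr_gt0// mulVf// gt_eqF.
have := hT0 _ T00 _ Sv `|v| Tv; rewrite scalerA mulfV ?gt_eqF// scale1r.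
by rewrite pairingZr pmulr_rgt0 ?invr_gt0.
Qed.

Lemma exists_momentum_zero : exists v, Fmom (ex (imulK v)) = 0.
Proof.
have [T T0 hT] := momentum_outward.
apply: (zero_of_outward_field (F := fun v => Fmom (ex (imulK v))) T0) => //.
rewrite (_ : (fun v => _) = (fun v => Fmom (ex (imulK (1 *: v))))).
  exact: continuous_momentum_ex.
by apply/funext => v; rewrite scale1r.
Qed.

(** * Stabilizers *)

Lemma pairing_momentum_K k h v : pairing (Fmom (iota k * h)%g) v =
  pairing (Fmom h) (Ad eK k^-1%g v).
Proof.
rewrite !pairing_momentum; congr (mean nu _); apply/funext => x.
rewrite aGM (hx_extends G_action); exact: (mm_equivariant mu_momentum).
Qed.

Lemma momentum_K_eq0 k h : Fmom h = 0 -> Fmom (iota k * h)%g = 0.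
Proof.
move=> h0; apply/rowP => j; rewrite -pairing_delta.
by apply: etrans (pairing_momentum_K k h (delta_mx 0 j)) _; rewrite h0 pairing0l mxE.
Qed.

Lemma momentum_Kl k h : Fmom (iota k * h)%g = 0 -> Fmom h = 0.
Proof.
move=> h0; have -> : h = (iota k^-1 * (iota k * h))%g by rewrite iotaV mulKg.
exact: momentum_K_eq0.
Qed.

Lemma polar_ex (p : G) : exists k v, p = (iota k * ex (imulK v))%g.
Proof.
have [_ [f' [_ f'K _]]] := cplx_polar G_complexification.
by exists (f' p).1, (f' p).2; rewrite -[LHS]f'K.
Qed.

Lemma momentum_stabilizer h s : measure_stabilizer aG nu s ->
  Fmom (h * s)%g = Fmom h.
Proof.
move=> Ss; rewrite !momentum_push; apply/rowP => j; rewrite !mxE.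
have c1 : continuous (fun x => mu (aG h x) 0 j : R).
  move=> x; apply: (@continuous_comp _ _ _ (aG h) (fun x => mu x 0 j : R)).
    exact: continuous_aG.
  exact: continuous_mu_coord.
have cid : continuous (id : M -> M) by move=> x; exact: cvg_id.
have := @mean_comp_eq _ _ nu M_compact (aG s) id _ (@continuous_aG s) cid c1 Ss.
by move=> <-; congr (mean nu _); apply/funext => x /=; rewrite aGM.
Qed.

(** The nonnegative function mu^v (exp(iv) h x) - mu^v (h x) has integral
    <F(exp(iv) h), v> - <F(h), v> = 0, hence vanishes for almost every x, and then
    mu is constant on the flow line from h x. *)
Lemma momentum_geodesic h v : Fmom h = 0 -> Fmom (ex (imulK v) * h)%g = 0 ->
  forall t, Fmom (ex (t *: imulK v) * h)%g = 0.
Proof.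
move=> h0 h1 t.
have c0 := @continuous_mu_aG v h; have c1 := @continuous_mu_aG v (ex (imulK v) * h)%g.
have flow1 x : aG (ex (imulK v) * h)%g x = flow v (aG h x) 1.
  by rewrite aGM /iflow scale1r.
have nonneg x : 0 <= mu_comp mu v (aG (ex (imulK v) * h)%g x) - mu_comp mu v (aG h x).
  by rewrite flow1 subr_ge0 -{1}(flow0 v (aG h x)); exact: mu_flow_nondecreasing.
have cB : continuous (fun x =>
    mu_comp mu v (aG (ex (imulK v) * h)%g x) - mu_comp mu v (aG h x) : R).
  move=> x; apply: (@continuousB R R^o _
    (fun x => mu_comp mu v (aG (ex (imulK v) * h)%g x))); [exact: c1|exact: c0].
have mean0 : mean nu (fun x =>
    mu_comp mu v (aG (ex (imulK v) * h)%g x) - mu_comp mu v (aG h x)) = 0.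
  rewrite meanB//; have := pairing_momentum h v.
  have := pairing_momentum (ex (imulK v) * h)%g v.
  by rewrite h0 h1 pairing0l => <- <-; rewrite subrr.
have ae0 := mean_eq0 M_compact cB nonneg mean0.
rewrite -[RHS]h0 !momentum_push; apply/rowP => j; rewrite !mxE.
have cj h' : continuous (fun x => mu (aG h' x) 0 j : R).
  move=> x; apply: (@continuous_comp _ _ _ (aG h') (fun x => mu x 0 j : R)).
    exact: continuous_aG.
  exact: continuous_mu_coord.
apply: (@eq_mean_ae _ _ nu M_compact _ _ (cj _) (cj _)).
apply: ae_sub ae0 => x /eqP.
rewrite subr_eq0 flow1 => /eqP /mu_flow_stationary/(_ t).
by rewrite /iflow aGM => ->.
Qed.

(** Write exp(itv) h = k_t exp(i w_t).  Then F(exp(i w_t)) = 0 bounds w_t, so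
    exp(itv) stays in a compact set, whereas tv is its second polar coordinate. *)
Lemma bounded_geodesic h v :
  (forall t, Fmom (ex (t *: imulK v) * h)%g = 0) -> v = 0.
Proof.
move=> Fh0; have [T T0 outT] := momentum_outward.
have [[pc _] [f' [f'K _ [f'c _]]]] := cplx_polar G_complexification.
pose B := [set w : 'rV[R]_n | `|w| <= T].
have Bc : compact B := @compact_norm_le R n T.
(* The second polar coordinate of k exp(iw) h^-1. *)
pose psi (p : K * 'rV[R]_n) : 'rV[R]_n :=
  (f' (iota p.1 * ex (imulK p.2) * h^-1)%g).2.
have psic : continuous psi.
  have c1 : continuous (fun p : K * 'rV[R]_n => (iota p.1 * ex (imulK p.2) * h^-1)%g).
    move=> p; apply: (@continuous_comp _ _ _
      (fun p : K * 'rV[R]_n => ((iota p.1 * ex (imulK p.2))%g, (h^-1)%g))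
      (fun p : G * G => (p.1 * p.2)%g)); last exact: (lie_mul G_lie).1.
    by apply: continuous_pair => // z; exact: cst_continuous.
  move=> p; apply: (@cvg_comp _ _ _ _ (snd \o f') _ _ _ (c1 p)).
  by apply: (@cvg_comp _ _ _ f' snd _ _ _ (f'c _)); exact: cvg_snd.
have [C0 [_ psiC]] : bounded_set (psi @` ([set: K] `*` B)).
  apply: compact_bounded; apply: continuous_compact.
    exact: continuous_subspaceT.
  exact: compact_setX.
have tv t : `|t *: v| <= C0 + 1.
  apply: psiC; first by rewrite ltrDl.
  have [k [w kw]] := polar_ex (ex (t *: imulK v) * h)%g.
  have Fw : Fmom (ex (imulK w)) = 0 by apply: (@momentum_Kl k); rewrite -kw.
  exists (k, w).
    split => //=; rewrite /B/= leNgt; apply/negP => /ltW/outT.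
    by rewrite Fw pairing0l ltxx.
  rewrite /psi/= -kw mulgK -imulZ.
  have := f'K (1%g, t *: v); rewrite /= iota1 mul1g => ->//.
apply/eqP/negP => /negP v0.
have nv0 : 0 < `|v| by rewrite normr_gt0.
have C0' : 0 <= C0 + 1 by apply: le_trans (tv 0).
have := tv ((C0 + 2) / `|v|).
rewrite normrZ normrM normfV normr_id divfK ?gt_eqF//.
by rewrite ger0_norm; lra.
Qed.

Lemma stabilizer_sub_K h s : Fmom h = 0 -> measure_stabilizer aG nu s ->
  exists k, (h * s * h^-1)%g = iota k.
Proof.
move=> h0 Ss; have [k [v kv]] := polar_ex (h * s * h^-1)%g.
have hs : (h * s)%g = (iota k * (ex (imulK v) * h))%g.
  by rewrite mulgA -kv mulgVK.
have v0 : v = 0.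
  apply: (@bounded_geodesic h); apply: momentum_geodesic => //.
  by apply: (@momentum_Kl k); rewrite -hs momentum_stabilizer.
have := imulZ 0 0; rewrite !scale0r => imul0.
by exists k; rewrite kv v0 imul0 ex0 mulg1.
Qed.

Lemma stabilizer1 : measure_stabilizer aG nu 1%g.
Proof.
move=> B mB; rewrite /push /pushforward; congr (nu _).
by apply/seteqP; split=> x; rewrite /preimage/= aG1.
Qed.

Lemma stabilizerM s t : measure_stabilizer aG nu s -> measure_stabilizer aG nu t ->
  measure_stabilizer aG nu (s * t)%g.
Proof.
move=> Ss St B mB; rewrite -[RHS]Ss// -[RHS]St.
  rewrite /push /pushforward; congr (nu _).
  by apply/seteqP; split=> x; rewrite /preimage/= aGM.
rewrite -[X in measurable X]setTI.
exact: (continuous_self_measurable (@continuous_aG s)).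
Qed.

Lemma stabilizerV s : measure_stabilizer aG nu s ->
  measure_stabilizer aG nu s^-1%g.
Proof.
move=> Ss B mB; rewrite -[LHS]Ss.
  rewrite /push /pushforward; congr (nu _).
  by apply/seteqP; split=> x; rewrite /preimage/= -aGM mulVg aG1.
rewrite -[X in measurable X]setTI.
exact: (continuous_self_measurable (@continuous_aG s^-1%g)).
Qed.

(** The subalgebra is the Lie algebra of the subgroup of K that corresponds to
    h G_nu h^-1; smooth curves are transported in both directions, from G to K
    by the first polar coordinate. *)
Lemma stable_of_momentum_zero h : Fmom h = 0 ->
  exists l : set 'rV[R]_n, lie_subalgebra eK l /\
    Ad eG h @` lie_algebra_of eG (measure_stabilizer aG nu)
      = diota eK eG iota @` l.
Proof.
move=> h0.
pose H : set K := [set k | measure_stabilizer aG nu (h^-1 * iota k * h)%g].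
exists (lie_algebra_of eK H); split.
  apply: lie_subalgebra_of_subgroup => //.
  - by rewrite /H/= iota1 mulg1 mulVg; exact: stabilizer1.
  - move=> x y Hx Hy; rewrite /H/= (cplx_morph G_complexification).
    have -> : (h^-1 * (iota x * iota y) * h =
        (h^-1 * iota x * h) * (h^-1 * iota y * h))%g.
      by rewrite !mulgA mulgK.
    exact: stabilizerM.
  - move=> x Hx; rewrite /H/= iotaV.
    have -> : (h^-1 * (iota x)^-1 * h = (h^-1 * iota x * h)^-1)%g.
      by rewrite !invgM invgK !mulgA.
    exact: stabilizerV.
have bG := bCn n.
have velocity_iota (k : R -> K) : smooth_curve AK k -> k 0 = 1%g ->
    smooth_curve AG (iota \o k) /\
    velocity eG (iota \o k) = diota eK eG iota (velocity eK k).
  move=> sk k0; have si := cplx_smooth G_complexification.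
  split; first exact: (smooth_comp cR cK cG (@smooth_basis_rV R n) sk si).
  have ik0 : cdom AG eG (iota (k 0)) by rewrite k0 iota1; exact: lie_chart1 G_lie.
  have ek0 : cdom AK eK (k 0) by rewrite k0; exact: lie_chart1 K_lie.
  have := @dmap_comp _ _ _ _ _ _ _ TR AK AG cR cK iota k tt eK eG 0 1 sk si I ek0 ik0.
  by rewrite k0.
apply/seteqP; split.
  move=> _ [_ [c [sc c0 cS <-]] <-].
  have [[pc _] [f' [f'K f'K' [f'c f's]]]] := cplx_polar G_complexification.
  pose c' t := (h * c t * h^-1)%g.
  have sc' : smooth_curve AG c' := smooth_curve_conj G_lie bG h sc.
  pose k t := (f' (c' t)).1.
  have f'iota y : f' (iota y) = (y, 0).
    have := f'K (y, 0); rewrite /= (_ : imulK 0 = 0) ?ex0 ?mulg1//.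
    by have := imulZ 0 0; rewrite !scale0r.
  have c'k : c' = iota \o k.
    apply/funext => t; have [x hx] := stabilizer_sub_K h0 (cS t).
    by rewrite /k /= /c' hx f'iota.
  have sk : smooth_curve AK k.
    have cV : charted (triv_atlas ('rV[R]_n : normedModType R)) := charted_triv _.
    have bV := @smooth_basis_rV R n.
    have s1 := smooth_comp cR cG (charted_prod cK cV) bG sc' (conj f'c f's).
    exact: (smooth_comp cR (charted_prod cK cV) cK (smooth_basis_prod bV bV) s1
      (smooth_fst bV (lie_manifold K_lie) cV)).
  have k0 : k 0 = 1%g by rewrite /k /c' c0 mulg1 mulgV -iota1 f'iota.
  exists (velocity eK k).
    exists k; split=> // t; rewrite /H/=.
    have -> : iota (k t) = (h * c t * h^-1)%g by rewrite -[RHS]/(c' t) c'k.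
    by rewrite !mulgA mulVg mul1g mulgVK.
  have [_ <-] := velocity_iota k sk k0.
  by rewrite -c'k; exact: (velocity_conj G_lie bG h sc c0).
move=> _ [_ [k [sk k0 kH <-]] <-].
have [sik <-] := velocity_iota k sk k0.
pose c t := (h^-1 * iota (k t) * h^-1^-1)%g.
have sc : smooth_curve AG c := smooth_curve_conj G_lie bG (h^-1)%g sik.
have c0 : c 0 = 1%g by rewrite /c k0 iota1 mulg1 mulgV.
exists (velocity eG c).
  by exists c; split=> // t; rewrite /c invgK; exact: kH.
rewrite -(velocity_conj G_lie bG h sc c0); congr velocity.
by apply/funext => t; rewrite /c invgK /= !mulgA mulgV mul1g mulgK.
Qed.

End KaehlerAction.

Theorem theorem5p31 (R : realType) (n d : nat)
  (M : ptopologicalType) (AM : atlas (Cn R d) M) (g : tensor2 AM)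
  (K : topGroupType) (AK : atlas 'rV[R]_n K) (eK : ix AK)
  (G : topGroupType) (AG : atlas (Cn R n) G) (eG : ix AG)
  (iota : K -> G) (ex : Cn R n -> G)
  (aK : K -> M -> M) (aG : G -> M -> M) (mu : M -> 'rV[R]_n)
  (q : 'rV[R]_n -> 'rV[R]_n -> R)
  (M_compact : compact [set: M])
  (M_kaehler : kaehler g)
  (K_compact : compact [set: K])
  (K_connected : connected [set: K])
  (K_lie : lie_group eK)
  (K_action : kaehler_action g eK aK)
  (mu_momentum : momentum_map g eK aK mu)
  (G_complexification : complexification eK eG iota ex)
  (G_action : holomorphic_extension g eK eG iota aK aG mu)
  (flow_limits : forall (x : M) (v : 'rV[R]_n),
     exists y : M, iflow eK eG iota ex aG v x t @[t --> +oo] --> y)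
  (q_invariant : invariant_scalar_product eK q)
  (nu : probability (borel M) R)
  (nu_W : measures_W eK eG iota ex aG mu q nu)
  (zero_Omega : Omega mu 0) :
  stable eK eG iota aG mu nu /\
  polystable aG mu nu /\
  exists h : G, momentum mu (push aG h nu) = 0.
Proof.
have [q_sp _] := q_invariant.
have [v Fv] := exists_momentum_zero M_compact M_kaehler K_lie mu_momentum
  G_complexification G_action flow_limits q_sp nu_W zero_Omega.
pose h := ex (imul eK eG iota v).
have poly : polystable aG mu nu.
  have [nu' nu'E] := exists_pushforward nu
    (continuous_aG M_kaehler G_complexification G_action (h := h)).
  exists nu'; split; last by rewrite nu'E.
  by exists h => B _; rewrite nu'E.
split; last by split=> //; exists h.
split=> //; exists h.
exact: (stable_of_momentum_zero M_compact M_kaehler K_compact K_lie mu_momentum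
  G_complexification G_action flow_limits q_sp nu_W zero_Omega Fv).
Qed.
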